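(* Let $p$ be a prime and let $1\le m\le\infty$ be an integer or infinity. The $m$-truncated $p$-typical Witt vectors functor $W_m(-;p)$ extends from ring homomorphisms to the partial category of multiplicative polynomial maps of degree at most $p-1$. That is, for every $n<p$, a multiplicative $n$-polynomial map $f\colon A\to B$ of commutative rings induces a multiplicative $n$-polynomial map $$W_m(f)\colon W_m(A;p)\longrightarrow W_m(B;p),$$ with the property that if $f\colon A\to B$ and $g\colon B\to C$ are multiplicative and $n$- and $k$-polynomial, respectively, and $nk<p$, then $W_m(g)\circ W_m(f)=W_m(g\circ f)$. This extension is unique with the property that $$w\circ W_m(f)=\Big(\prod_{j=0}^{m-1}f\Big)\circ w$$ for every such $f$, where $w$ denotes the ghost maps $W_m(A;p)\to\prod_{j=0}^{m-1}A$ and $W_m(B;p)\to\prod_{j=0}^{m-1}B$.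
   Context: Rings are commutative and unital; ring homomorphisms are not required to be unital. For a function $f\colon A\to B$ between abelian groups, the $n$-th cross-effect is $(\mathrm{cr}_nf)(a_1,\dots,a_n)=\sum_{U\subset\{1,\dots,n\}}(-1)^{n-|U|}f(\sum_{l\in U}a_l)$, and $f$ is $n$-polynomial (polynomial of degree $\le n$), $n\ge0$, if $\mathrm{cr}_{n+1}f=0$. A function $f\colon A\to B$ of rings is a multiplicative $n$-polynomial map if it is $n$-polynomial and $f(aa')=f(a)f(a')$ for all $a,a'$ (not necessarily $f(1)=1$). $W_m(A;p)$ is the ring of $p$-typical $m$-truncated Witt vectors: as a set $\prod_{j=0}^{m-1}A$ (for $m=\infty$, $\prod_{j\ge0}A$), with the unique ring structure natural in $A$ for which the ghost map $w\colon W_m(A;p)\to\prod_{j=0}^{m-1}A$ with components $w_j(a_0,a_1,\dots)=\sum_{i=0}^jp^ia_i^{p^{j-i}}$ is a ring homomorphism. ''Extends'' means that for a ring homomorphism $f$, $W_m(f)$ is the usual induced ring homomorphism (given by $f$ in each Witt coordinate). *)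

(* Defs.v *)
From HB Require Import structures.
From mathcomp Require Import all_boot all_order all_algebra finmap boolp.
From mathcomp.multinomials Require Import monalg.

Set Implicit Arguments.
Unset Strict Implicit.
Unset Printing Implicit Defensive.

Import GRing.Theory.
Local Open Scope ring_scope.

Definition cross_effect (A B : zmodType) (n : nat) (f : A -> B)
    (a : 'I_n -> A) : B :=
  \sum_(U : {set 'I_n}) f (\sum_(l in U) a l) *~ (-1) ^+ (n - #|U|).

Definition polynomial_map (A B : zmodType) (n : nat) (f : A -> B) : Prop :=
  forall a : 'I_n.+1 -> A, cross_effect f a = 0.

Definition mult_polynomial_map (A B : comPzRingType) (n : nat) (f : A -> B) :
    Prop :=
  polynomial_map n f /\ {morph f : x y / x * y}.

Definition nonunital_hom (A B : comPzRingType) (f : A -> B) : Prop :=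
  {morph f : x y / x + y} /\ {morph f : x y / x * y}.

Definition ghost_seq (p : nat) (R : pzRingType) (a : nat -> R) (j : nat) : R :=
  \sum_(i < j.+1) (a i ^+ (p ^ (j - i))) *+ (p ^ i).

(* A truncation length is [Some m], or [None] for m = oo. *)
Definition below (m : option nat) (j : nat) : bool :=
  if m is Some k then (j < k)%N else true.

Definition windex (m : option nat) : Type := {j : nat | below m j}.

(* The proof that p is prime is a parameter of the type because the ring
   structure put on it below exists only for p prime. *)
Record witt (p : nat) (p_pr : prime p) (m : option nat) (A : comPzRingType) :
  Type := Witt { wcomp : windex m -> A }.

Arguments Witt {p} p_pr {m A} wcomp.
Arguments wcomp {p p_pr m A} _ _.

(* Components, extended by zero past the truncation length. *)
Definition wcoef (p : nat) (p_pr : prime p) (m : option nat)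
    (A : comPzRingType) (a : witt p_pr m A) (i : nat) : A :=
  oapp (wcomp a) 0 (insub i).

Definition ghost (p : nat) (p_pr : prime p) (m : option nat)
    (A : comPzRingType) (a : witt p_pr m A) (j : windex m) : A :=
  ghost_seq p (wcoef a) (val j).

Definition wmap (p : nat) (p_pr : prime p) (m : option nat)
    (A B : comPzRingType) (f : A -> B) (a : witt p_pr m A) : witt p_pr m B :=
  Witt p_pr (fun j => f (wcomp a j)).

Definition zpoly (V : choiceType) : comPzRingType := {malg int[{cmonom V}]}.

Definition zvar (V : choiceType) (v : V) : zpoly V :=
  mkmalgU (ucm v) (1 : int).

Definition meval (V : choiceType) (A : comPzRingType) (h : V -> A)
    (k : {cmonom V}) : A :=
  \prod_(v <- finsupp k) h v ^+ k v.

Definition zeval (V : choiceType) (A : comPzRingType) (h : V -> A)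
    (g : zpoly V) : A :=
  \sum_(k <- msupp g) meval h k *~ mcoeff k g.

Section Eval.
Variables (V : choiceType) (A : comPzRingType) (h : V -> A).
Local Notation M := {malg int[{cmonom V}]}.

Lemma mevalEw (d : {fset V}) (k : {cmonom V}) :
  (finsupp k `<=` d)%fset -> meval h k = \prod_(v <- d) h v ^+ k v.
Proof.
move=> le; rewrite /meval (big_fset_incl _ le) //= => x xd.
by rewrite -cmE_eq0 => /eqP ->.
Qed.

Lemma meval1 : meval h mone = 1.
Proof. by rewrite /meval mdom1 big_seq_fset0. Qed.

Lemma mevalM k l : meval h (mmul k l) = meval h k * meval h l.
Proof.
rewrite {1}/meval mdomD.
rewrite (mevalEw (fsubsetUl (finsupp k) (finsupp l))).
rewrite (mevalEw (fsubsetUr (finsupp k) (finsupp l))).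
by rewrite -big_split /=; apply: eq_bigr => v _; rewrite cmM exprD.
Qed.

Lemma mevalU v : meval h (ucm v) = h v.
Proof. by rewrite /meval mdomU big_seq_fset1 cmUU expr1. Qed.

Lemma zevalEw (d : {fset {cmonom V}}) (g : M) :
  (msupp g `<=` d)%fset -> zeval h g = \sum_(k <- d) meval h k *~ mcoeff k g.
Proof.
move=> le; rewrite /zeval (big_fset_incl _ le) //= => x xd /mcoeff_outdom ->.
by rewrite mulr0z.
Qed.

Lemma zevalU k c : zeval h (mkmalgU k c) = meval h k *~ c.
Proof. by rewrite (zevalEw msuppU_le) big_seq_fset1 mcoeffUU. Qed.

Lemma zeval_var v : zeval h (zvar v) = h v.
Proof. by rewrite zevalU mevalU. Qed.

Fact zeval_is_zmod_morphism : zmod_morphism (zeval h : M -> A).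
Proof.
move=> g1 g2.
have s1 := fsubsetUl (msupp g1) (msupp g2).
have s2 := fsubsetUr (msupp g1) (msupp g2).
rewrite (zevalEw (msuppB_le _ _)) (zevalEw s1) (zevalEw s2) -sumrB.
by apply: eq_bigr => k _; rewrite mcoeffB mulrzBr.
Qed.
HB.instance Definition _ := GRing.isZmodMorphism.Build (zpoly V) A (zeval h)
  zeval_is_zmod_morphism.

Fact zeval_is_monoid_morphism : monoid_morphism (zeval h : M -> A).
Proof.
pose f : {additive M -> A} := HB.pack (zeval h : M -> A)
  (GRing.isZmodMorphism.Build M A (zeval h) zeval_is_zmod_morphism).
split=> [|g1 g2]; first by rewrite zevalU meval1.
rewrite malgME (raddf_sum f) /= [in RHS]/zeval mulr_suml; apply: eq_bigr => i _.
rewrite (raddf_sum f) mulr_sumr /=; apply: eq_bigr => j _.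
by rewrite zevalU mevalM mulrzAl mulrzAr mulrzA mulrzAC.
Qed.
HB.instance Definition _ := GRing.isMonoidMorphism.Build (zpoly V) A (zeval h)
  zeval_is_monoid_morphism.

End Eval.

Definition cong (R : comPzRingType) (k : nat) (x y : R) : Prop :=
  exists z, x = y + z *+ k.

Section Cong.
Variables (p : nat) (p_pr : prime p) (R : comPzRingType).
Implicit Types (k : nat) (x y z : R).

Lemma cong_refl k x : cong k x x.
Proof. by exists 0; rewrite mul0rn addr0. Qed.

Lemma cong_sym k x y : cong k x y -> cong k y x.
Proof. by case=> z ->; exists (- z); rewrite mulNrn addrK. Qed.

Lemma cong_trans k x y z : cong k x y -> cong k y z -> cong k x z.
Proof.
by move=> [u ->] [v ->]; exists (v + u); rewrite mulrnDl addrA.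
Qed.

Lemma congD k x1 y1 x2 y2 :
  cong k x1 y1 -> cong k x2 y2 -> cong k (x1 + x2) (y1 + y2).
Proof.
by move=> [u ->] [v ->]; exists (u + v); rewrite mulrnDl addrACA.
Qed.

Lemma congN k x y : cong k x y -> cong k (- x) (- y).
Proof. by move=> [u ->]; exists (- u); rewrite mulNrn opprD. Qed.

Lemma congM k x1 y1 x2 y2 :
  cong k x1 y1 -> cong k x2 y2 -> cong k (x1 * x2) (y1 * y2).
Proof.
move=> [u ->] [v ->]; exists (y1 * v + u * y2 + (u * v) *+ k).
rewrite mulrDl !mulrDr !mulrnDl !mulrnAl !mulrnAr -!addrA.
by congr (_ + _); congr (_ + _).
Qed.

Lemma congMn k l x y : cong k x y -> cong (k * l) (x *+ l) (y *+ l).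
Proof. by move=> [u ->]; exists u; rewrite mulrnDl mulrnA. Qed.

Lemma cong_sum k (I : Type) (r : seq I) (F G : I -> R) :
  (forall i, cong k (F i) (G i)) ->
  cong k (\sum_(i <- r) F i) (\sum_(i <- r) G i).
Proof.
move=> FG; elim/big_ind2: _ => //; first exact: cong_refl.
by move=> *; apply: congD.
Qed.

Lemma cong_dvd k l x y : (k %| l)%N -> cong l x y -> cong k x y.
Proof.
by move=> /dvdnP[q ->] [u ->]; exists (u *+ q); rewrite -mulrnA.
Qed.

Lemma cong0 k x : cong k (x *+ k) 0.
Proof. by exists x; rewrite add0r. Qed.

Lemma cong_sum0 k (I : Type) (r : seq I) (F : I -> R) :
  (forall i, cong k (F i) 0) -> cong k (\sum_(i <- r) F i) 0.
Proof.
move=> F0; elim/big_rec: _ => [|i x _]; first exact: cong_refl.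
by move=> H; rewrite -[X in cong _ _ X](addr0 0); apply: congD.
Qed.

Lemma cong_exprDp x y : cong p ((x + y) ^+ p) (x ^+ p + y ^+ p).
Proof.
have p_gt0 := prime_gt0 p_pr.
rewrite exprDn -(prednK p_gt0) big_ord_recl big_ord_recr /= prednK //.
have -> : bump 0 p.-1 = p by rewrite /bump add1n prednK.
rewrite subn0 bin0 subnn binn.
rewrite !expr0 mulr1 mul1r !mulr1n.
apply: congD; first exact: cong_refl.
rewrite -[X in cong _ _ X]add0r; apply: congD; last exact: cong_refl.
apply: cong_sum0 => i.
have ip : (bump 0 i < p)%N by rewrite /bump add1n -[X in (_ < X)%N](prednK p_gt0) ltnS.
apply: cong_dvd (cong0 _ _).
by rewrite prime_dvd_bin // ip.
Qed.

Lemma expr0np : 0 ^+ p = 0 :> R.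
Proof. by rewrite expr0n gtn_eqF // prime_gt0. Qed.

Lemma cong_exprNp x : cong p (- x ^+ p) ((- x) ^+ p).
Proof.
have := cong_exprDp x (- x); rewrite subrr expr0np.
by move/(congD (cong_refl p (- x ^+ p))); rewrite addr0 addKr.
Qed.

Lemma cong_expr_p k x y :
  cong (p ^ k.+1) x y -> cong (p ^ k.+2) (x ^+ p) (y ^+ p).
Proof.
have p_gt1 := prime_gt1 p_pr.
case=> z ->; rewrite exprDn big_ord_recl /= subn0 bin0 expr0 mulr1 mulr1n.
rewrite -[X in cong _ _ X]addr0; apply: congD; first exact: cong_refl.
apply: cong_sum0 => i; rewrite /bump add1n.
rewrite exprMn_n mulrnAr -mulrnA.
apply: cong_dvd (cong0 _ _).
have [ip|pi] := ltnP i.+1 p.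
  rewrite expnSr dvdn_mul ?prime_dvd_bin // -expnM dvdn_exp2l //.
  by rewrite leq_pmulr.
apply: dvdn_mulr; rewrite -expnM dvdn_exp2l // mulSn addnC.
rewrite (leq_trans _ (leq_add (leqnn _) (leq_trans p_gt1 pi))) // addn2 !ltnS.
by rewrite leq_pmulr.
Qed.

Lemma cong_expr_exp k n x y :
  cong (p ^ k.+1) x y -> cong (p ^ (k + n).+1) (x ^+ (p ^ n)) (y ^+ (p ^ n)).
Proof.
move=> xy; elim: n => [|n IHn]; first by rewrite addn0 expn0 !expr1.
by rewrite addnS (expnSr p n) !exprM; apply: cong_expr_p.
Qed.

Lemma cong_frob_sum (phi : {rmorphism R -> R}) (I : Type) (r : seq I)
    (F : I -> R) (c : I -> int) :
  (forall i, cong p (phi (F i)) (F i ^+ p)) ->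
  cong p (phi (\sum_(i <- r) F i *~ c i)) ((\sum_(i <- r) F i *~ c i) ^+ p).
Proof.
pose P (x : R) := cong p (phi x) (x ^+ p).
have P0 : P 0 by rewrite /P rmorph0 expr0np; apply: cong_refl.
have PD x y : P x -> P y -> P (x + y).
  rewrite /P rmorphD => Px Py; apply: cong_trans (congD Px Py) _.
  exact/cong_sym/cong_exprDp.
have PN x : P x -> P (- x).
  rewrite /P rmorphN => Px; apply: cong_trans (congN Px) _.
  exact: cong_exprNp.
have Pn x n : P x -> P (x *+ n).
  by move=> Px; elim: n => [|n IHn]; rewrite ?mulr0n ?mulrS //; apply: PD.
move=> PF; rewrite -/(P _); elim/big_ind: _ => // i _.
case: (c i) => n; first exact/Pn/PF.
by rewrite NegzE mulrNz; apply/PN/Pn/PF.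
Qed.

End Cong.

Section FrobeniusLift.
Variables (p : nat) (p_pr : prime p) (V : choiceType).
Local Notation U := (zpoly V).

Lemma mkmalgUM (k l : {cmonom V}) :
  mkmalgU (mmul k l) (1 : int) = mkmalgU k 1 * mkmalgU l 1 :> U.
Proof. by rewrite malgM_def fgmulUU mulr1. Qed.

Lemma meval_zvar (k : {cmonom V}) : meval (@zvar V) k = mkmalgU k 1.
Proof.
have X (v : V) n : zvar v ^+ n = mkmalgU (iter n (mmul (ucm v)) mone) 1 :> U.
  by elim: n => [|n IHn]; [exact: expr0 | rewrite exprS IHn iterS mkmalgUM].
have E (v : V) n i : iter n (mmul (ucm v)) mone i = (n * (v == i))%N.
  by elim: n => [|n IHn]; rewrite ?cm1 // iterS cmM IHn cmU mulSn.
rewrite /meval; under eq_bigr => v _ do rewrite X.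
rewrite -(big_morph (fun k => mkmalgU k 1 : U) mkmalgUM (erefl _)).
set K := (X in mkmalgU X _); suff -> : K = k by [].
rewrite /K; apply/eqP/cmP => i.
rewrite (big_morph (fun k : {cmonom V} => k i) (cmM i) (cm1 i)).
under eq_bigr => v _ do rewrite E.
have [ik|] := boolP (i \in finsupp k); last first.
  move=> ik; move: (ik); rewrite -cmE_eq0 => /eqP ->.
  rewrite big1_seq // => v /= vk; case: eqP => [vi|_]; last by rewrite muln0.
  by rewrite -vi vk in ik.
rewrite (big_fsetD1 i) //= eqxx muln1 big1_seq ?addn0 // => v /=.
by rewrite in_fsetD1 => /andP[/negPf -> _]; rewrite muln0.
Qed.

Lemma zpolyE (g : U) : g = \sum_(k <- msupp g) meval (@zvar V) k *~ mcoeff k g.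
Proof.
rewrite {1}[g]monalgE; apply: eq_bigr => k _; rewrite meval_zvar.
by rewrite -(raddfMz (mkmalgU k)) intz.
Qed.

Definition frob_lift : U -> U := zeval (fun v => zvar v ^+ p).

HB.instance Definition _ := GRing.RMorphism.on frob_lift.

Lemma frob_liftP (g : U) : cong p (frob_lift g) (g ^+ p).
Proof.
rewrite [g]zpolyE; apply: (cong_frob_sum p_pr) => k.
rewrite /meval rmorph_prod -prodrXl.
under eq_bigr => v _ do rewrite rmorphXn /= /frob_lift zeval_var exprAC.
exact: cong_refl.
Qed.

Lemma zpoly_torsion_free n (g : U) : g *+ n.+1 = 0 -> g = 0.
Proof.
move=> gn; apply/malgP => k; move/(congr1 (mcoeff k)): gn.
by rewrite mcoeffMn mcoeff0 => /eqP; rewrite Num.Theory.mulrn_eq0 /= => /eqP.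
Qed.

End FrobeniusLift.

Section Dwork.
Variables (p : nat) (p_pr : prime p).

Lemma ghost_seqS (R : comPzRingType) (s : nat -> R) j :
  ghost_seq p s j =
  \sum_(i < j) (s i ^+ (p ^ (j - i))) *+ (p ^ i) + s j *+ p ^ j.
Proof. by rewrite /ghost_seq big_ord_recr /= subnn expn0 expr1. Qed.

Section Lift.
Variables (R : comPzRingType) (phi : {rmorphism R -> R}).
Hypothesis phiP : forall x, cong p (phi x) (x ^+ p).

Lemma ghost_seq_cong (s : nat -> R) j :
  cong (p ^ j.+1) (ghost_seq p s j.+1) (phi (ghost_seq p s j)).
Proof.
rewrite ghost_seqS -[X in cong _ _ X]addr0; apply: congD; last exact: cong0.
rewrite /ghost_seq rmorph_sum /=; apply: cong_sum => i.
have ij : (i <= j)%N by rewrite -ltnS.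
rewrite rmorphMn rmorphXn /= subSn // (expnS p (j - i)) exprM.
rewrite -[X in cong (p ^ X.+1) _ _](subnK ij) -addSn expnD.
apply/congMn/cong_sym/(cong_expr_exp p_pr (k := 0)).
by rewrite expn1.
Qed.

Lemma dwork (b : nat -> R) :
  (forall j, cong (p ^ j.+1) (b j.+1) (phi (b j))) ->
  exists s, forall j, ghost_seq p s j = b j.
Proof.
move=> bP.
pose quot k (x : R) : R :=
  if pselect (exists z, x = z *+ k) is left h then projT1 (cid h) else 0.
have quotP k x : (exists z, x = z *+ k) -> x = quot k x *+ k.
  by rewrite /quot; case: pselect => // h _; case: (cid h).
pose rest (s : nat -> R) j : R :=
  \sum_(i < j) (s i ^+ (p ^ (j - i))) *+ (p ^ i).
pose L := fix L j := if j is j'.+1 then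
  rcons (L j') (quot (p ^ j')%N (b j' - rest (nth 0 (L j')) j')) else [::].
pose s j := nth 0 (L j.+1) j.
have sizeL j : size (L j) = j by elim: j => //= j IH; rewrite size_rcons IH.
have nthL i j : (i < j)%N -> nth 0 (L j) i = s i.
  elim: j => // j IH; rewrite ltnS leq_eqVlt => /orP[/eqP -> //|ij].
  by rewrite /= nth_rcons sizeL ij IH.
have sE j : s j = quot (p ^ j)%N (b j - rest s j).
  rewrite {1}/s /= nth_rcons sizeL ltnn eqxx; congr (quot _ (_ - _)).
  by apply: eq_bigr => i _; rewrite nthL.
exists s; elim/ltn_ind => j IH; rewrite ghost_seqS -/(rest s j) sE.
rewrite -quotP ?[_ + (_ - _)]addrC ?subrK //.
case: j IH => [|j] IH; first by exists (b 0%N - rest s 0%N); rewrite mulr1n.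
have [u bu] := bP j.
have := ghost_seq_cong s j; rewrite (IH j) // ghost_seqS -/(rest s j.+1).
case=> v /(canRL (addrK _)) ->; rewrite bu.
exists (u - v + s j.+1); rewrite mulrnDl mulrnBl.
by rewrite opprB [s _ *+ _ - _]addrC opprD addrA addrACA subrr add0r.
Qed.

End Lift.

Lemma ghost_seq_inj (R : comPzRingType) (s t : nat -> R) (P : pred nat) :
  (forall n (x : R), x *+ n.+1 = 0 -> x = 0) ->
  (forall j, ~~ P j -> s j = t j) ->
  (forall j, P j -> ghost_seq p s j = ghost_seq p t j) -> s =1 t.
Proof.
move=> tf sPt gst; elim/ltn_ind => j IH.
have [/gst|] := boolP (P j); last exact: sPt.
rewrite !ghost_seqS.
have -> : \sum_(i < j) (s i ^+ (p ^ (j - i))) *+ (p ^ i) =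
          \sum_(i < j) (t i ^+ (p ^ (j - i))) *+ (p ^ i).
  by apply: eq_bigr => i _; rewrite IH.
move/addrI/eqP; rewrite -subr_eq0 -mulrnBl => /eqP.
have /prednK <- : (0 < p ^ j)%N by rewrite expn_gt0 prime_gt0.
by move/tf/subr0_eq.
Qed.

End Dwork.

Lemma rmorph_ghost_seq p (R S : comPzRingType) (g : {rmorphism R -> S})
    (s : nat -> R) j :
  g (ghost_seq p s j) = ghost_seq p (g \o s) j.
Proof.
rewrite /ghost_seq rmorph_sum; apply: eq_bigr => i _ /=.
by rewrite rmorphMn rmorphXn.
Qed.

Lemma rmorph_zeval (V : choiceType) (R S : comPzRingType)
    (g : {rmorphism R -> S}) (h : V -> R) (P : zpoly V) :
  g (zeval h P) = zeval (g \o h) P.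
Proof.
rewrite /zeval rmorph_sum; apply: eq_bigr => k _; rewrite raddfMz /=.
rewrite /meval rmorph_prod; congr (_ *~ _); apply: eq_bigr => v _.
by rewrite rmorphXn.
Qed.

Lemma zeval_ghost_seq p (V : choiceType) (R : comPzRingType) (h : V -> R)
    (v : nat -> V) j :
  zeval h (ghost_seq p (fun i => zvar (v i)) j) = ghost_seq p (h \o v) j.
Proof.
rewrite (rmorph_ghost_seq p (zeval h)).
by apply: eq_bigr => i _; rewrite /= zeval_var.
Qed.

Section WittPolynomials.
Variables (p : nat) (p_pr : prime p).
Local Notation U := (zpoly (nat + nat)%type).

Definition Xvar (i : nat) : U := zvar (inl i).
Definition Yvar (i : nat) : U := zvar (inr i).

Fact witt_add_subproof : exists s : nat -> U,
  forall j, ghost_seq p s j = ghost_seq p Xvar j + ghost_seq p Yvar j.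
Proof.
apply: (dwork p_pr (b := fun j => ghost_seq p Xvar j + ghost_seq p Yvar j)
  (frob_liftP p_pr (V := (nat + nat)%type))) => j.
by rewrite rmorphD; apply: congD; apply: (ghost_seq_cong p_pr (frob_liftP p_pr (V := _))).
Qed.

Fact witt_opp_subproof : exists s : nat -> U,
  forall j, ghost_seq p s j = - ghost_seq p Xvar j.
Proof.
apply: (dwork p_pr (b := fun j => - ghost_seq p Xvar j)
  (frob_liftP p_pr (V := (nat + nat)%type))) => j.
by rewrite rmorphN; apply: congN; apply: (ghost_seq_cong p_pr (frob_liftP p_pr (V := _))).
Qed.

Fact witt_mul_subproof : exists s : nat -> U,
  forall j, ghost_seq p s j = ghost_seq p Xvar j * ghost_seq p Yvar j.
Proof.
apply: (dwork p_pr (b := fun j => ghost_seq p Xvar j * ghost_seq p Yvar j)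
  (frob_liftP p_pr (V := (nat + nat)%type))) => j.
by rewrite rmorphM; apply: congM; apply: (ghost_seq_cong p_pr (frob_liftP p_pr (V := _))).
Qed.

(* The three equations above determine these polynomials, by [ghost_seq_inj]. *)
Definition witt_addp : nat -> U := projT1 (cid witt_add_subproof).
Definition witt_oppp : nat -> U := projT1 (cid witt_opp_subproof).
Definition witt_mulp : nat -> U := projT1 (cid witt_mul_subproof).

End WittPolynomials.

HB.instance Definition _ p (p_pr : prime p) m A :=
  gen_eqMixin (witt p_pr m A).
HB.instance Definition _ p (p_pr : prime p) m A :=
  gen_choiceMixin (witt p_pr m A).

Definition wvars p (p_pr : prime p) m A (a b : witt p_pr m A) (v : nat + nat) :
    A :=
  match v with inl i => wcoef a i | inr i => wcoef b i end.

(* Locked so that unification never unfolds the universal polynomials. *)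
HB.lock Definition wadd p (p_pr : prime p) m A (a b : witt p_pr m A) :
    witt p_pr m A :=
  Witt p_pr (fun j => zeval (wvars a b) (witt_addp p_pr (val j))).
HB.lock Definition wopp p (p_pr : prime p) m A (a : witt p_pr m A) :
    witt p_pr m A :=
  Witt p_pr (fun j => zeval (wvars a a) (witt_oppp p_pr (val j))).
HB.lock Definition wmul p (p_pr : prime p) m A (a b : witt p_pr m A) :
    witt p_pr m A :=
  Witt p_pr (fun j => zeval (wvars a b) (witt_mulp p_pr (val j))).
HB.lock Definition wzero p (p_pr : prime p) m A : witt p_pr m A :=
  Witt p_pr (fun=> 0).
HB.lock Definition wone p (p_pr : prime p) m A : witt p_pr m A :=
  Witt p_pr (fun j => (val j == 0%N)%:R).

Section WittOps.
Variables (p : nat) (p_pr : prime p) (m : option nat).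
Local Notation W := (witt p_pr m).
Local Notation wzero := (wzero p_pr m).
Local Notation wone := (wone p_pr m).
Local Notation wadd := (@wadd p p_pr m _).
Local Notation wopp := (@wopp p p_pr m _).
Local Notation wmul := (@wmul p p_pr m _).

Section Ghost.
Variable A : comPzRingType.
Implicit Types a b : W A.

Lemma wittP a b : (forall j, wcomp a j = wcomp b j) -> a = b.
Proof. by case: a b => [f] [g] /= fg; congr Witt; apply: funext. Qed.

Lemma wcoefE a (j : windex m) : wcoef a (val j) = wcomp a j.
Proof. by rewrite /wcoef valK. Qed.

Lemma wcoef_out a i : ~~ below m i -> wcoef a i = 0.
Proof. by move=> im; rewrite /wcoef insubN. Qed.

Lemma below_leq i j : (i <= j)%N -> below m j -> below m i.
Proof. by case: m => //= k; apply: leq_ltn_trans. Qed.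

Lemma ghost_Witt (f : nat -> A) (j : windex m) :
  ghost (Witt p_pr (fun j => f (val j))) j = ghost_seq p f (val j).
Proof.
rewrite /ghost /ghost_seq; apply: eq_bigr => i _; congr (_ ^+ _ *+ _).
have im : below m i by apply: below_leq (valP j); rewrite -ltnS.
by rewrite /wcoef insubT.
Qed.

Lemma zeval_X a b j :
  zeval (wvars a b) (ghost_seq p Xvar j) = ghost_seq p (wcoef a) j.
Proof. exact: (zeval_ghost_seq p (wvars a b) inl). Qed.

Lemma zeval_Y a b j :
  zeval (wvars a b) (ghost_seq p Yvar j) = ghost_seq p (wcoef b) j.
Proof. exact: (zeval_ghost_seq p (wvars a b) inr). Qed.

Lemma ghost_add a b j : ghost (wadd a b) j = ghost a j + ghost b j.
Proof.
rewrite wadd.unlock (ghost_Witt (fun i => zeval (wvars a b) (witt_addp p_pr i))).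
rewrite -[LHS](rmorph_ghost_seq p (zeval (wvars a b))).
rewrite /witt_addp; case: (cid _) => s /= ->; rewrite rmorphD /=.
by congr (_ + _); [exact: zeval_X | exact: zeval_Y].
Qed.

Lemma ghost_opp a j : ghost (wopp a) j = - ghost a j.
Proof.
rewrite wopp.unlock (ghost_Witt (fun i => zeval (wvars a a) (witt_oppp p_pr i))).
rewrite -[LHS](rmorph_ghost_seq p (zeval (wvars a a))).
rewrite /witt_oppp; case: (cid _) => s /= ->; rewrite rmorphN /=.
by congr (- _); exact: zeval_X.
Qed.

Lemma ghost_mul a b j : ghost (wmul a b) j = ghost a j * ghost b j.
Proof.
rewrite wmul.unlock (ghost_Witt (fun i => zeval (wvars a b) (witt_mulp p_pr i))).
rewrite -[LHS](rmorph_ghost_seq p (zeval (wvars a b))).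
rewrite /witt_mulp; case: (cid _) => s /= ->; rewrite rmorphM /=.
by congr (_ * _); [exact: zeval_X | exact: zeval_Y].
Qed.

Lemma ghost_zero j : ghost (wzero A) j = 0.
Proof.
rewrite wzero.unlock (ghost_Witt (fun=> 0)) /ghost_seq big1 // => i _.
by rewrite expr0n gtn_eqF ?mul0rn // expn_gt0 prime_gt0.
Qed.

Lemma ghost_one j : ghost (wone A) j = 1.
Proof.
rewrite wone.unlock (ghost_Witt (fun i => (i == 0%N)%:R)) /ghost_seq.
rewrite big_ord_recl /= expr1n mulr1n big1 ?addr0 // => i _.
by rewrite expr0n gtn_eqF ?mul0rn // expn_gt0 prime_gt0.
Qed.

End Ghost.

Lemma wcoef_wmap (A B : comPzRingType) (g : {rmorphism A -> B}) (a : W A) i :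
  wcoef (wmap g a) i = g (wcoef a i).
Proof. by rewrite /wcoef; case: insub => //=; rewrite rmorph0. Qed.

Lemma wvars_wmap (A B : comPzRingType) (g : {rmorphism A -> B}) (a b : W A) :
  g \o wvars a b = wvars (wmap g a) (wmap g b).
Proof. by apply: funext => -[i|i] /=; rewrite wcoef_wmap. Qed.

Lemma wmap_add (A B : comPzRingType) (g : {rmorphism A -> B}) (a b : W A) :
  wmap g (wadd a b) = wadd (wmap g a) (wmap g b).
Proof. by apply: wittP => j; rewrite wadd.unlock /= rmorph_zeval wvars_wmap. Qed.

Lemma wmap_opp (A B : comPzRingType) (g : {rmorphism A -> B}) (a : W A) :
  wmap g (wopp a) = wopp (wmap g a).
Proof. by apply: wittP => j; rewrite wopp.unlock /= rmorph_zeval wvars_wmap. Qed.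

Lemma wmap_mul (A B : comPzRingType) (g : {rmorphism A -> B}) (a b : W A) :
  wmap g (wmul a b) = wmul (wmap g a) (wmap g b).
Proof. by apply: wittP => j; rewrite wmul.unlock /= rmorph_zeval wvars_wmap. Qed.

Lemma wmap_zero (A B : comPzRingType) (g : {rmorphism A -> B}) :
  wmap g (wzero A) = wzero B.
Proof. by apply: wittP => j; rewrite wzero.unlock /= rmorph0. Qed.

Lemma wmap_one (A B : comPzRingType) (g : {rmorphism A -> B}) :
  wmap g (wone A) = wone B.
Proof. by apply: wittP => j; rewrite wone.unlock /= rmorph_nat. Qed.

Lemma ghost_inj (R : comPzRingType) (a b : W R) :
  (forall n (x : R), x *+ n.+1 = 0 -> x = 0) ->
  (forall j, ghost a j = ghost b j) -> a = b.
Proof.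
move=> tf gab; apply: wittP => j; rewrite -!wcoefE.
apply: (ghost_seq_inj p_pr (P := below m)) => // i im.
  by rewrite !wcoef_out.
exact: (gab (exist _ i im)).
Qed.

(* The ring axioms descend from the torsion-free cover Z[A] of A, over which the
   ghost map is injective. *)
Section Ring.
Variable A : comPzRingType.
Implicit Types a b c : W A.

Let Z : comPzRingType := zpoly A.
Let ev : Z -> A := zeval id.
HB.instance Definition _ := GRing.RMorphism.on ev.

Let wev := @wmap p p_pr m Z A ev.

Variant wlift_spec : W A -> Prop := WLift (a : W Z) : wlift_spec (wev a).

Let wliftP a : wlift_spec a.
Proof.
have -> : a = wev (Witt p_pr (fun j => zvar (wcomp a j))).
  by apply: wittP => j; rewrite /= /ev zeval_var.
exact: WLift.
Qed.

Let wev_eq (a b : W Z) : (forall j, ghost a j = ghost b j) -> wev a = wev b.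
Proof.
by move=> ab; rewrite (ghost_inj _ ab) //; apply: zpoly_torsion_free.
Qed.

Let wsimp := (ghost_add, ghost_opp, ghost_mul, ghost_zero, ghost_one).

Let wevD (a b : W Z) : wadd (wev a) (wev b) = wev (wadd a b).
Proof. exact/esym/wmap_add. Qed.
Let wevN (a : W Z) : wopp (wev a) = wev (wopp a).
Proof. exact/esym/wmap_opp. Qed.
Let wevM (a b : W Z) : wmul (wev a) (wev b) = wev (wmul a b).
Proof. exact/esym/wmap_mul. Qed.
Let wev0 : wzero A = wev (wzero Z).
Proof. exact/esym/wmap_zero. Qed.
Let wev1 : wone A = wev (wone Z).
Proof. exact/esym/wmap_one. Qed.

Fact waddA : associative (wadd : W A -> W A -> W A).
Proof.
move=> a b c; case: (wliftP a) (wliftP b) (wliftP c) => {}a [{}b] [{}c].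
rewrite (wevD b c) (wevD a b) (wevD a (wadd b c)) (wevD (wadd a b) c).
by apply: wev_eq => j; rewrite !wsimp; exact: addrA.
Qed.

Fact waddC : commutative (wadd : W A -> W A -> W A).
Proof.
move=> a b; case: (wliftP a) (wliftP b) => {}a [{}b].
rewrite (wevD a b) (wevD b a).
by apply: wev_eq => j; rewrite !wsimp; exact: addrC.
Qed.

Fact wadd0 : left_id (wzero A) (wadd : W A -> W A -> W A).
Proof.
move=> a; case: (wliftP a) => {}a.
rewrite wev0 (wevD (wzero Z) a).
by apply: wev_eq => j; rewrite !wsimp; exact: add0r.
Qed.

Fact waddN : left_inverse (wzero A) (wopp : W A -> W A) (wadd : W A -> W A -> W A).
Proof.
move=> a; case: (wliftP a) => {}a.
rewrite (wevN a) (wevD (wopp a) a) wev0.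
by apply: wev_eq => j; rewrite !wsimp; exact: addNr.
Qed.

Fact wmulA : associative (wmul : W A -> W A -> W A).
Proof.
move=> a b c; case: (wliftP a) (wliftP b) (wliftP c) => {}a [{}b] [{}c].
rewrite (wevM b c) (wevM a b) (wevM a (wmul b c)) (wevM (wmul a b) c).
by apply: wev_eq => j; rewrite !wsimp; exact: mulrA.
Qed.

Fact wmulC : commutative (wmul : W A -> W A -> W A).
Proof.
move=> a b; case: (wliftP a) (wliftP b) => {}a [{}b].
rewrite (wevM a b) (wevM b a).
by apply: wev_eq => j; rewrite !wsimp; exact: mulrC.
Qed.

Fact wmul1 : left_id (wone A) (wmul : W A -> W A -> W A).
Proof.
move=> a; case: (wliftP a) => {}a.
rewrite wev1 (wevM (wone Z) a).
by apply: wev_eq => j; rewrite !wsimp; exact: mul1r.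
Qed.

Fact wmulDl : left_distributive (wmul : W A -> W A -> W A) (wadd : W A -> W A -> W A).
Proof.
move=> a b c; case: (wliftP a) (wliftP b) (wliftP c) => {}a [{}b] [{}c].
rewrite (wevD a b) (wevM (wadd a b) c) (wevM a c) (wevM b c)
  (wevD (wmul a c) (wmul b c)).
by apply: wev_eq => j; rewrite !wsimp; exact: mulrDl.
Qed.

HB.instance Definition _ := GRing.isZmodule.Build (W A) waddA waddC wadd0 waddN.
HB.instance Definition _ := GRing.Zmodule_isComPzRing.Build (W A)
  wmulA wmulC wmul1 wmulDl.

End Ring.

Lemma ghostD (A : comPzRingType) (a b : W A) j :
  ghost (a + b) j = ghost a j + ghost b j.
Proof. exact: ghost_add. Qed.

Lemma ghostM (A : comPzRingType) (a b : W A) j :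
  ghost (a * b) j = ghost a j * ghost b j.
Proof. exact: ghost_mul. Qed.

Lemma ghost1 (A : comPzRingType) j : ghost (1 : W A) j = 1.
Proof. exact: ghost_one. Qed.

Lemma wmapD (A B : comPzRingType) (g : {rmorphism A -> B}) :
  {morph (@wmap p p_pr m A B g) : a b / a + b}.
Proof. exact: wmap_add. Qed.

Lemma wmapM (A B : comPzRingType) (g : {rmorphism A -> B}) :
  {morph (@wmap p p_pr m A B g) : a b / a * b}.
Proof. exact: wmap_mul. Qed.

Lemma wmap1 (A B : comPzRingType) (g : {rmorphism A -> B}) :
  wmap g (1 : W A) = 1.
Proof. exact: wmap_one. Qed.

End WittOps.

Section Extension.
Variables (p : nat) (p_pr : prime p) (m : option nat).

(* An assignment on morphisms is total here, but it is only constrained on the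
   multiplicative polynomial maps of degree less than p: its values on all other
   functions are irrelevant. *)
Variable W : forall A B : comPzRingType,
  (A -> B) -> witt p_pr m A -> witt p_pr m B.

Definition witt_extension : Prop :=
  [/\ forall (A B : comPzRingType) (f : A -> B),
        nonunital_hom f -> W f =1 wmap f,
      forall (n : nat) (A B : comPzRingType) (f : A -> B),
        (n < p)%N -> mult_polynomial_map n f -> mult_polynomial_map n (W f) &
      forall (n k : nat) (A B C : comPzRingType) (f : A -> B) (g : B -> C),
        (n < p)%N -> (k < p)%N -> (n * k < p)%N ->
        mult_polynomial_map n f -> mult_polynomial_map k g ->
        W g \o W f =1 W (g \o f)].

Definition ghost_compatible : Prop :=
  forall (n : nat) (A B : comPzRingType) (f : A -> B),
    (n < p)%N -> mult_polynomial_map n f ->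
    forall (a : witt p_pr m A) (j : windex m),
      ghost (W f a) j = f (ghost a j).

End Extension.

(* Main.v *)
From HB Require Import structures.
Require Import Defs.
From mathcomp Require Import all_boot all_order all_algebra.
From mathcomp Require Import boolp functions.
From mathcomp.multinomials Require Import monalg.
From mathcomp Require Import ring zify.

Set Implicit Arguments.
Unset Strict Implicit.
Unset Printing Implicit Defensive.

Import GRing.Theory Num.Theory.
Local Open Scope ring_scope.

(** If the ghost map of W(B) were injective, W(f) would be forced by the ghost
    equation, and only its existence would be in question. So the proof moves
    the problem to rings in which the ghost map is injective.

    Every ring A is a quotient of a polynomial ring T over the integers, and
    every multiplicative polynomial map of degree < k out of T factors as a
    ring homomorphism after a universal one, T -> [univ k T]. The universal
    target is the monoid ring of T under multiplication, modulo the
    combinations that all rational-valued maps of degree < k send to 0; in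
    this form it is visibly torsion-free, even separated by its additive maps
    to the rationals. That it is universal for all targets, torsion included,
    is [deg_lt_extendable]: an integral combination of points of a separated
    group that is killed by all products of fewer than k affine maps to the
    rationals is killed by every map of degree < k ([moments_span]).

    The bound on the degree enters through [deg_lt_cong]: a map of degree < p
    preserves congruences modulo p ^ s, because p ^ s divides the binomial
    coefficients C(p ^ s, j) with 0 < j < p in its Newton expansion. Hence the
    Frobenius lift of T induces a Frobenius lift on [univ p T], and the image
    of a ghost sequence of T satisfies Dwork's congruences there, so that it is
    a ghost sequence ([witt_univ_ex]). This is W of the universal map; for
    f : A -> B, one lifts a Witt vector of A to T, applies this, and comes back
    to W(B) by the homomorphism [univ p T] -> B ([wext]).

    All properties of W then follow one pattern: lift to T, factor through a
    universal ring, where ghost components decide, and push forward along a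
    homomorphism. Two points need more. The homomorphisms that come out of the
    factorization need not preserve 1; they are made unital on a product with
    the ring of integers ([unitalized]). And W(g) W(f) = W(g f) compares two
    maps into a universal ring over [univ n.+1 T], which is not a polynomial
    ring; this is why universality is proved over all separated rings. *)

(** * Maps of bounded degree *)

Lemma additive0 (A B : zmodType) (f : A -> B) :
  {morph f : x y / x + y} -> f 0 = 0.
Proof. by move=> fD; apply: (addrI (f 0)); rewrite -fD !addr0. Qed.

Lemma additiveN (A B : zmodType) (f : A -> B) :
  {morph f : x y / x + y} -> {morph f : x / - x}.
Proof. by move=> fD x; apply: (addrI (f x)); rewrite -fD !subrr additive0. Qed.

Lemma additiveB (A B : zmodType) (f : A -> B) :
  {morph f : x y / x + y} -> {morph f : x y / x - y}.
Proof. by move=> fD x y; rewrite fD additiveN. Qed.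

Lemma additiveMz (A B : zmodType) (f : A -> B) (c : int) :
  {morph f : x y / x + y} -> {morph f : x / x *~ c}.
Proof.
move=> fD x; have fMn n : f (x *+ n) = f x *+ n.
  by elim: n => [|n IH]; rewrite ?mulr0n ?additive0 // !mulrS fD IH.
by case: c => n; rewrite ?NegzE ?mulrNz ?additiveN // -!pmulrn fMn.
Qed.

Lemma additive_sum (A B : zmodType) (f : A -> B) (I : Type) (r : seq I)
    (F : I -> A) :
  {morph f : x y / x + y} -> f (\sum_(i <- r) F i) = \sum_(i <- r) f (F i).
Proof. by move=> fD; rewrite (big_morph f fD (additive0 fD)). Qed.

Section Differences.
Variables A B : zmodType.
Implicit Types (f g : A -> B) (x h : A).

Definition diff h f x : B := f (x + h) - f x.

(** Degree by iterated differences at every point; the strict bound k makes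
    k = 0 the zero map, so that [diff h] lowers k by one with no exception. *)
Fixpoint deg_lt k f : Prop :=
  if k is k'.+1 then forall h, deg_lt k' (diff h f) else forall x, f x = 0.

Lemma eq_deg_lt k f g : f =1 g -> deg_lt k f -> deg_lt k g.
Proof. by move/funext ->. Qed.

Lemma deg_lt_zero k f : (forall x, f x = 0) -> deg_lt k f.
Proof.
by elim: k f => // k IH f f0 h; apply: IH => x; rewrite /diff !f0 subrr.
Qed.

Lemma deg_ltS k f : deg_lt k f -> deg_lt k.+1 f.
Proof.
elim: k f => [|k IH] f; first exact: deg_lt_zero.
by move=> fk h; apply: IH; apply: fk.
Qed.

Lemma deg_ltW k l f : (k <= l)%N -> deg_lt k f -> deg_lt l f.
Proof. by move/subnK <-; elim: (l - k)%N => // n IH /IH /deg_ltS. Qed.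

Lemma deg_ltD k f g : deg_lt k f -> deg_lt k g -> deg_lt k (f \+ g).
Proof.
elim: k f g => [|k IH] f g fk gk; first by move=> x /=; rewrite fk gk addr0.
move=> h; apply: eq_deg_lt (IH _ _ (fk h) (gk h)) => x.
by rewrite /diff /= opprD addrACA.
Qed.

Lemma deg_lt_shift k f a : deg_lt k f -> deg_lt k (fun x => f (x + a)).
Proof.
elim: k f => [|k IH] f fk; first by move=> x; exact: fk.
by move=> h; apply: eq_deg_lt (IH _ (fk h)) => x; rewrite /diff addrAC.
Qed.

(** By induction on m, from f (x + h) = f x + diff h f x and Pascal's rule; the
    terms of index at least k of the usual expansion vanish. *)
Lemma newton k f x h m : deg_lt k f ->
  f (x + h *+ m) = \sum_(j < k) iter j (diff h) f x *+ 'C(m, j).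
Proof.
elim: k f m => [|k IHk] f m fk; first by rewrite big_ord0 fk.
elim: m => [|m IHm].
  rewrite mulr0n addr0 big_ord_recl bin0 mulr1n big1 ?addr0 //.
rewrite mulrSr addrA -[LHS](subrK (f (x + h *+ m))).
rewrite -[X in X + _]/(diff h f (x + h *+ m)) IHk; last exact: fk.
rewrite IHm !big_ord_recl !bin0 addrCA; congr (_ + _).
rewrite -big_split; apply: eq_bigr => i _.
by rewrite lift0 binS mulrnDr addrC -iterSr.
Qed.

End Differences.

Lemma deg_lt_post (A B C : zmodType) (e : B -> C) (f : A -> B) k :
  {morph e : x y / x + y} -> deg_lt k f -> deg_lt k (e \o f).
Proof.
move=> eD; elim: k f => [|k IH] f fk.
  by move=> x; rewrite /= fk additive0.
by move=> h; apply: eq_deg_lt (IH _ (fk h)) => x; rewrite /diff /= additiveB.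
Qed.

Lemma deg_lt_pre (A B C : zmodType) (e : A -> B) (f : B -> C) k :
  {morph e : x y / x + y} -> deg_lt k f -> deg_lt k (f \o e).
Proof.
move=> eD; elim: k f => [|k IH] f fk; first by move=> x; exact: fk.
by move=> h; apply: eq_deg_lt (IH _ (fk (e h))) => x; rewrite /diff /= eD.
Qed.

Lemma deg_lt_additive (A B : zmodType) (f : A -> B) :
  {morph f : x y / x + y} -> deg_lt 2 f.
Proof.
by move=> fD h h' x; rewrite /diff !(fD _ h) ![_ + f h]addrC !addrK subrr.
Qed.

(** Degree can be tested after composing with any jointly injective family of
    additive maps. *)
Lemma deg_lt_separated (A B C : zmodType) (I : Type) (e : I -> B -> C)
    (f : A -> B) k :
  (forall i, {morph e i : x y / x + y}) ->
  (forall x, (forall i, e i x = 0) -> x = 0) ->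
  (forall i, deg_lt k (e i \o f)) -> deg_lt k f.
Proof.
move=> eD e_inj; elim: k f => [|k IH] f fk.
  by move=> x; apply: e_inj => i; exact: fk.
move=> h; apply: IH => i; apply: eq_deg_lt (fk i h) => x.
by rewrite /diff /= additiveB.
Qed.

Lemma deg_lt_surj (A B C : zmodType) (e : A -> B) (f : B -> C) k :
  {morph e : x y / x + y} -> (forall y, exists x, e x = y) ->
  deg_lt k (f \o e) -> deg_lt k f.
Proof.
move=> eD e_surj; elim: k f => [|k IH] f fk.
  by move=> y; have [x <-] := e_surj y; exact: fk.
move=> y; have [h <-] := e_surj y; apply: IH; apply: eq_deg_lt (fk h) => x.
by rewrite /diff /= eD.
Qed.

(** Leibniz rule: the difference by h of (l + c) g is
    (l + c) diff h g + (l h) g(. + h). *)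
Lemma deg_lt_affineM (A : zmodType) (R : comPzRingType) (l : A -> R) (c : R)
    (g : A -> R) k :
  {morph l : x y / x + y} -> deg_lt k g ->
  deg_lt k.+1 (fun x => (l x + c) * g x).
Proof.
move=> lD; elim: k g => [|k IH] g gk.
  by apply: deg_lt_zero => x; rewrite gk mulr0.
move=> h.
have gh : deg_lt k.+1 (fun x => g (x + h) * l h).
  apply: (@deg_lt_post _ _ _ ( *%R^~ (l h)) (fun x => g (x + h))).
    by move=> x y; rewrite mulrDl.
  exact: deg_lt_shift.
apply: eq_deg_lt (deg_ltD (IH _ (gk h)) gh) => x.
by rewrite /diff /= lD; ring.
Qed.

Section CrossEffects.
Variables A B : zmodType.
Implicit Types f : A -> B.

(** A subset of n+1 indices is a subset of the last n ones, with or without the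
    first. *)
Lemma big_setS n (F : {set 'I_n.+1} -> B) :
  \sum_U F U = \sum_(V : {set 'I_n})
    (F (ord0 |: lift ord0 @: V) + F (lift ord0 @: V)).
Proof.
have liftK (V : {set 'I_n}) : lift ord0 @^-1: (lift ord0 @: V) = V.
  by apply/setP => i; rewrite inE mem_imset //; exact: lift_inj.
have lift0 (V : {set 'I_n}) : ord0 \notin lift ord0 @: V.
  by apply/imsetP => -[i _ /eqP]; rewrite (negPf (neq_lift _ _)).
rewrite big_split (bigID (fun U : {set 'I_n.+1} => ord0 \in U)) /=.
congr (_ + _).
  rewrite (reindex_onto (fun V : {set 'I_n} => ord0 |: lift ord0 @: V)
    (fun U => lift ord0 @^-1: U)) /=.
    apply: eq_bigl => V; rewrite setU11; apply/eqP.
    rewrite preimsetU liftK; apply/setP => i; rewrite !inE.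
    by rewrite eq_sym (negPf (neq_lift _ _)).
  move=> U U0; apply/setP => i; rewrite !inE.
  case: (unliftP ord0 i) => [j ->|-> //].
  rewrite eq_sym (negPf (neq_lift _ _)) /= mem_imset; last exact: lift_inj.
  by rewrite inE.
rewrite (reindex_onto (fun V : {set 'I_n} => lift ord0 @: V)
    (fun U => lift ord0 @^-1: U)) /=.
  by apply: eq_bigl => V; rewrite lift0 liftK eqxx.
move=> U U0; apply/setP => i.
case: (unliftP ord0 i) => [j ->|->].
  by rewrite mem_imset ?inE //; exact: lift_inj.
by rewrite (negPf U0) (negPf (lift0 _)).
Qed.

(** Grouping the subsets U by whether they contain the first index turns the
    cross-effect of f into one of a difference of f. *)
Lemma cross_effectS n f (a : 'I_n.+1 -> A) :
  cross_effect f a = cross_effect (diff (a ord0) f) (a \o lift ord0).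
Proof.
rewrite /cross_effect big_setS; apply: eq_bigr => V _.
have V0 : ord0 \notin lift ord0 @: V.
  by apply/imsetP => -[i _ /eqP]; rewrite (negPf (neq_lift _ _)).
have lV : (#|V| <= n)%N by rewrite -[X in (_ <= X)%N](card_ord n) max_card.
rewrite cardsU1 V0 big_setU1 //= card_imset; last exact: lift_inj.
rewrite big_imset /=; last by move=> i j _ _ /lift_inj.
rewrite add1n subSS subSn // exprS mulN1r mulrNz -mulrzBl.
by rewrite /diff addrC.
Qed.

Lemma deg_lt_cross_effect n f (a : 'I_n -> A) :
  deg_lt n f -> cross_effect f a = 0.
Proof.
elim: n f a => [|n IH] f a fn; last by rewrite cross_effectS IH.
by rewrite /cross_effect big1 // => U _; rewrite fn mul0rz.
Qed.

Lemma cross_effect0 f (a : 'I_0 -> A) : cross_effect f a = f 0.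
Proof.
rewrite /cross_effect (big_pred1 set0) => [|U]; last first.
  by apply/esym/eqP/setP => -[].
by rewrite big_set0 cards0 subnn expr0 mulr1z.
Qed.

(** Cross-effects are iterated differences at 0 only. From right to left this is
    clear; in the other direction, the base case is the vanishing of
    f a - f 0 for all a, which says that f is constant. *)
Lemma polynomial_mapP n f : polynomial_map n f <-> deg_lt n.+1 f.
Proof.
split=> [|fn a]; last exact: deg_lt_cross_effect.
elim: n f => [|n IH] f fn.
  have f_const y : f y = f 0.
    have := fn (fun=> y); rewrite cross_effectS cross_effect0 /diff add0r.
    by move/eqP; rewrite subr_eq0 => /eqP.
  by move=> h x; rewrite /diff !(f_const (_ + _)) (f_const x) subrr.
move=> h; apply: IH => a.
(* b is a with h put in front. *)
pose b (i : 'I_n.+2) := oapp a h (unlift ord0 i).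
have := fn b; rewrite cross_effectS /b unlift_none /= => E; rewrite -[RHS]E.
by congr (cross_effect _ _); apply: funext => i /=; rewrite liftK.
Qed.

End CrossEffects.

(** From j * C(p ^ s, j) = p ^ s * C(p ^ s - 1, j - 1), j being prime to p. *)
Lemma prime_power_dvd_bin p s j : prime p -> (0 < j < p)%N ->
  (p ^ s %| 'C(p ^ s, j))%N.
Proof.
move=> p_pr /andP[j0 jp]; have cp : coprime (p ^ s) j.
  by rewrite coprimeXl // prime_coprime // gtnNdvd.
rewrite -(Gauss_dvdr _ cp) -(prednK j0).
have /prednK <- : (0 < p ^ s)%N by rewrite expn_gt0 prime_gt0.
by rewrite -mul_bin_diag dvdn_mulr.
Qed.

(** In the Newton expansion of f (y + p ^ s z) only the terms of index j < p
    survive, and those with j > 0 are multiples of p ^ s. *)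
Lemma deg_lt_cong (A B : comPzRingType) (f : A -> B) p s x y : prime p ->
  deg_lt p f -> cong (p ^ s) x y -> cong (p ^ s) (f x) (f y).
Proof.
case: p => // p p_pr fp [z ->]; rewrite (newton _ _ _ fp).
rewrite big_ord_recl bin0 mulr1n -[X in cong _ _ X]addr0.
apply: congD; first exact: cong_refl.
apply: cong_sum0 => i; apply: cong_dvd (cong0 _ _).
by apply: prime_power_dvd_bin; rewrite //= ltnS ltn_ord.
Qed.

(** * Degree of a composite *)

Section Composition.
Variables (A B C : zmodType) (n K : nat).
Implicit Types (f : A -> B) (H : A -> B -> C).

(** A filtration on maps with values in the maps B -> C. Weight s asks that the
    degree of H x be less than K - ceil(s / n), and each difference in x raises
    the weight by one; r bounds the number of differences that are tested, and
    is there for the inductions. The strict inequality states the bound without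
    division, for n = 0 too. *)
Fixpoint filtered r s H : Prop :=
  if r is r'.+1 then
    (forall x j, (n * K < s + n * j.+1)%N -> deg_lt j (H x)) /\
    (forall h, filtered r' s.+1 (diff h H))
  else True.

Definition translation_diff f H : A -> B -> C := fun x => diff (f x) (H x).

Lemma filteredW r s t H : (t <= s)%N -> filtered r s H -> filtered r t H.
Proof.
elim: r s t H => //= r IH s t H ts [Hj Hd]; split=> [x j jt|h].
  by apply: Hj; apply: leq_trans jt _; rewrite leq_add2r.
exact: IH (Hd h).
Qed.

Lemma filtered_pred r s H : filtered r.+1 s H -> filtered r s H.
Proof.
elim: r s H => // r IH s H [Hj Hd]; split=> // h; exact: IH (Hd h).
Qed.

Lemma filtered_zero r s H : (forall x y, H x y = 0) -> filtered r s H.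
Proof.
elim: r s H => //= r IH s H H0; split=> [x j _|h].
  by apply: deg_lt_zero => y; exact: H0.
by apply: IH => x y; rewrite /diff !fctE !H0 subrr.
Qed.

Lemma filteredD r s H1 H2 :
  filtered r s H1 -> filtered r s H2 -> filtered r s (H1 + H2).
Proof.
elim: r s H1 H2 => //= r IH s H1 H2 [j1 d1] [j2 d2]; split=> [x j js|h].
  by apply: deg_ltD; [exact: j1|exact: j2].
have -> : diff h (H1 + H2) = diff h H1 + diff h H2.
  by apply: funext => x; apply: funext => y; rewrite /diff !fctE opprD addrACA.
exact: IH.
Qed.

(** If f has degree < e <= n + 1, replacing H x by its difference along f x
    raises the weight by n + 1 - e. One difference in y is worth n, at least as
    much as n + 1 - e. For differences in x, write t_a for the translation by a;
    the difference by h of (t_f - 1) H is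
    t_f (t_(diff h f) - 1) H + (t_f(. + h) - 1) (diff h H), and diff h f has
    degree < e - 1. *)
Lemma filtered_translation_diff r s e f H :
  (e <= n.+1)%N -> deg_lt e f -> filtered r s H ->
  filtered r (s + (n.+1 - e)) (translation_diff f H).
Proof.
case: e => [|e].
  move=> _ f0 _; apply: filtered_zero => x y.
  by rewrite /translation_diff /diff f0 addr0 subrr.
rewrite ltnS subSS => en; elim: r s e en f H => //= r IH s e en f H fe.
move=> [Hj Hd]; split=> [x j jt|h].
  by apply: (Hj x j.+1) (f x); rewrite [(n * j.+2)%N]mulnS; lia.
have Hr : filtered r s H by apply: filtered_pred.
pose H1 := translation_diff (diff h f) H.
have H1r : filtered r (s + (n - e)).+1 H1.
  case: e en fe => [|e] en fe.
    apply: filtered_zero => x y.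
    by rewrite /H1 /translation_diff [diff h f x](fe h) /diff addr0 subrr.
  rewrite -addnS -subSn // subSS.
  by apply: IH => //; [lia|exact: fe].
have -> : diff h (translation_diff f H) = (H1 + translation_diff f H1) +
    translation_diff (fun x => f (x + h)) (diff h H).
  apply: funext => x; apply: funext => y.
  rewrite /H1 /translation_diff /diff !fctE.
  have -> : y + f x + (f (x + h) - f x) = y + f (x + h).
    by rewrite -addrA [f (x + h) - _]addrC addNKr.
  set a := H (x + h) _; set b := H (x + h) y; set c := H x (y + f x).
  set d := H x y; set e1 := H x _; set e2 := H x _.
  rewrite [e1 - d + _]addrC subrK [RHS]addrA [e2 - c + _]addrC.
  rewrite [X in _ = X + _]addrA.
  by rewrite subrK !opprB addrACA [RHS]addrACA [- b + _]addrC.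
apply: filteredD; first apply: filteredD => //.
  apply: (@filteredW _ ((s + (n - e)).+1 + (n - e))); first lia.
  exact: IH.
rewrite -addSn; apply: IH => //.
exact: (@deg_lt_shift _ _ e.+1).
Qed.

Lemma filtered_deg_lt r s H y : (n * K < s + r + n)%N ->
  filtered r.+1 s H -> deg_lt r (fun x => H x y).
Proof.
elim: r s H => [|r IH] s H ns [Hj Hd].
  by move=> x; apply: (Hj x 0%N _ y); rewrite muln1 -[s]addn0.
move=> h; have ns' : (n * K < s.+1 + r + n)%N by rewrite addSnnS.
exact: eq_deg_lt (IH _ _ ns' (Hd h)).
Qed.

End Composition.

(** The constant family g, translated by f, keeps weight 0 for K = k + 1; after
    n k + 1 differences in x its values have degree < 0, that is, vanish, and
    its value at 0 is g (f x). *)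
Lemma deg_lt_comp (A B C : zmodType) n k (f : A -> B) (g : B -> C) :
  deg_lt n.+1 f -> deg_lt k.+1 g -> deg_lt (n * k).+1 (g \o f).
Proof.
move=> fn gk; pose G : A -> B -> C := fun=> g.
have G0 r : filtered n k.+1 r 0 G.
  case: r => //= r; split=> [x j|h].
    by rewrite add0n ltn_mul2l ltnS => /andP[_ kj]; apply: deg_ltW gk.
  by apply: filtered_zero => x y; rewrite /diff !fctE subrr.
pose r := (n * k).+1.
have := filtered_translation_diff (leqnn _) fn (G0 r.+1).
rewrite subnn => /(fun H => filteredD H (G0 r.+1)) /filtered_deg_lt.
move=> /(_ 0); rewrite mulnS => /(_ ltac:(lia)); apply: eq_deg_lt => x.
by rewrite !fctE /translation_diff /diff add0r subrK.
Qed.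

(** * Finitely generated subgroups *)

Section Span.
Variable G : zmodType.
Implicit Types (x y h : G) (xs ys : seq G).

Fixpoint zspan xs x : Prop :=
  if xs is a :: s then exists m : int, zspan s (x - a *~ m) else x = 0.

Lemma zspan0 xs : zspan xs 0.
Proof. by elim: xs => //= a s IH; exists 0; rewrite subr0. Qed.

Lemma zspanD xs x y : zspan xs x -> zspan xs y -> zspan xs (x + y).
Proof.
elim: xs x y => [|a s IH] x y /=; first by move=> -> ->; rewrite addr0.
move=> [m xm] [l yl]; exists (m + l).
by rewrite mulrzDr opprD addrACA; apply: IH.
Qed.

Lemma zspanMz xs x c : zspan xs x -> zspan xs (x *~ c).
Proof.
elim: xs x => [|a s IH] x /=; first by move=> ->; rewrite mul0rz.
by move=> [m xm]; exists (m * c); rewrite mulrzA -mulrzBl; apply: IH.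
Qed.

Lemma zspan_cons a xs x : zspan xs x -> zspan (a :: xs) x.
Proof. by exists 0; rewrite mulr0z subr0. Qed.

Lemma zspan_head a xs : zspan (a :: xs) a.
Proof. by exists 1; rewrite mulr1z subrr; apply: zspan0. Qed.

Lemma zspan_mem xs x : x \in xs -> zspan xs x.
Proof.
elim: xs => // a s IH; rewrite inE => /orP[/eqP ->|/IH].
  exact: zspan_head.
exact: zspan_cons.
Qed.

Lemma zspan_trans xs ys x :
  (forall a, a \in xs -> zspan ys a) -> zspan xs x -> zspan ys x.
Proof.
elim: xs x => [|a s IH] x sub /=; first by move=> ->; apply: zspan0.
move=> [m xm]; rewrite -(subrK (a *~ m) x); apply: zspanD.
  by apply: IH xm => b bs; apply: sub; rewrite inE bs orbT.
by apply: zspanMz; apply: sub; rewrite mem_head.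
Qed.

Lemma zspan_additive_eq0 (H : zmodType) (l : G -> H) xs x :
  {morph l : x y / x + y} -> (forall a, a \in xs -> l a = 0) ->
  zspan xs x -> l x = 0.
Proof.
move=> lD; elim: xs x => [|a s IH] x l0 /=.
  by move=> ->; exact: additive0.
move=> [m xm]; rewrite -(subrK (a *~ m) x) lD (additiveMz _ lD).
rewrite (l0 a) ?mem_head //.
by rewrite mul0rz addr0; apply: IH xm => b bs; rewrite l0 // inE bs orbT.
Qed.

Lemma rat_bezout (a b : rat) :
  exists u v a' b' : int, a' * u + b' * v = 1 /\ a *~ b' = b *~ a'.
Proof.
have [b0|b0] := eqVneq b 0.
  by exists 1, 0, 1, 0; rewrite b0 mul0rz mulr0z.
pose m := numq a * denq b; pose n := numq b * denq a; pose g := gcdz m n.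
have n0 : n != 0 by rewrite mulf_neq0 ?numq_eq0 ?denq_neq0.
have g0 : g != 0 by rewrite gcdz_eq0 negb_and n0 orbT.
have [u [v uv]] := Bezoutz m n.
have mE : m = (m %/ g)%Z * g by rewrite divzK ?dvdz_gcdl.
have nE : n = (n %/ g)%Z * g by rewrite divzK ?dvdz_gcdr.
exists u, v, (m %/ g)%Z, (n %/ g)%Z; split.
  apply: (mulIf g0); rewrite mul1r -[RHS]uv [in RHS]mE [in RHS]nE; ring.
have gQ : g%:~R != 0 :> rat by rewrite intr_eq0.
apply: (mulIf gQ); rewrite -[a *~ _]mulrzr -[b *~ _]mulrzr.
rewrite -!mulrA -!intrM -mE -nE.
by rewrite /m /n !intrM !numqE; ring.
Qed.

(** Generators adapted to l, all but one in its kernel. They are found by taking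
    the given generators in turn: a new one a and the current h are replaced, by
    the unimodular substitution of [rat_bezout], by a pair whose second member
    is in the kernel. *)
Lemma zspan_kernel (l : G -> rat) a xs : {morph l : x y / x + y} ->
  exists h ys, [/\ (size ys <= size xs)%N, forall y, y \in ys -> l y = 0 &
    forall x, x \in a :: xs -> zspan (h :: ys) x].
Proof.
move=> lD; elim: xs a => [|b s IH] a.
  by exists a, [::]; split=> // x; rewrite inE => /eqP ->; apply: zspan_head.
have [h [ys [sz ys0 ysP]]] := IH b.
have [u [v [a' [b' [uv ab]]]]] := rat_bezout (l a) (l h).
pose h' := a *~ u + h *~ v; pose k := a *~ b' - h *~ a'.
exists h', (k :: ys); split=> // [y|].
  rewrite inE => /orP[/eqP ->|/ys0 //].
  by rewrite /k (additiveB lD) !(additiveMz _ lD) ab subrr.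
have aP : zspan [:: h', k & ys] a.
  have aE : a = h' *~ a' + k *~ v.
    rewrite /h' /k mulrzDl mulrzBl -!mulrzA (mulrC v a') addrACA subrr addr0.
    by rewrite -mulrzDr (mulrC u) uv mulr1z.
  by exists a', v; rewrite {1}aE [_ + k *~ v]addrC addrK subrr; exact: zspan0.
have hP : zspan [:: h', k & ys] h.
  have hE : h = h' *~ b' - k *~ u.
    rewrite /h' /k mulrzDl mulrzBl -!mulrzA opprB [h *~ _ - _]addrC addrACA.
    by rewrite (mulrC u) subrr add0r -mulrzDr addrC (mulrC v) uv mulr1z.
  exists b', (- u); rewrite {1}hE mulrNz opprK [_ - k *~ u]addrC addrK addNr.
  exact: zspan0.
move=> x; rewrite inE => /orP[/eqP -> //|/ysP]; apply: zspan_trans => y.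
rewrite inE => /orP[/eqP -> //|/zspan_mem yP].
by do 2!apply: zspan_cons.
Qed.

End Span.

(** * Polynomial maps and rational moments *)

Definition separated (G : zmodType) : Prop :=
  forall x : G,
    (forall l : G -> rat, {morph l : x y / x + y} -> l x = 0) -> x = 0.

Section Moments.
Variable G : zmodType.
Implicit Types (x y h : G) (a phi l : G -> rat).

Definition affine a : Prop := forall x y, a (x + y) = a x + a y - a 0.

(** Products of fewer than k affine maps. They have degree < k, and unlike
    arbitrary maps of degree < k they can be moved along a projection with
    rational coefficients. *)
Inductive affine_product : nat -> (G -> rat) -> Prop :=
| AffineProduct1 k : affine_product k.+1 (fun=> 1)
| AffineProductM k a phi : affine a -> affine_product k phi ->
    affine_product k.+1 (fun x => a x * phi x).

Lemma affine_additive a : affine a ->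
  {morph (fun x => a x - a 0) : x y / x + y}.
Proof. by move=> aA x y /=; rewrite aA; ring. Qed.

Lemma affine_product_deg_lt k phi : affine_product k phi -> deg_lt k phi.
Proof.
elim=> {k phi} [k h|k a phi aA _ phik].
  by apply: deg_lt_zero => x; rewrite /diff subrr.
have := deg_lt_affineM (a 0) (affine_additive aA) phik.
by apply: eq_deg_lt => x; rewrite subrK.
Qed.

Lemma affine_product_falling k phi l (M : nat) j : {morph l : x y / x + y} ->
  affine_product k phi ->
  affine_product (k + j)
    (fun x => (\prod_(i < j) (l x + M%:R - i%:R)) * phi x).
Proof.
move=> lD phik; elim: j => [|j IH].
  rewrite addn0 (_ : (fun _ => _) = phi) //.
  by apply: funext => x; rewrite big_ord0 mul1r.
rewrite addnS; set psi := (X in affine_product _ X).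
have -> : psi = fun x => (l x + M%:R - j%:R) *
    ((\prod_(i < j) (l x + M%:R - i%:R)) * phi x).
  by apply: funext => x; rewrite /psi big_ord_recr /=; ring.
by apply: AffineProductM IH => x y; rewrite lD (additive0 lD); ring.
Qed.

(** The projection x - (l x) h along h is not defined on all of G, since l x is
    only rational; but each affine factor a extends along it, as
    a x - l x (a h - a 0). *)
Lemma affine_product_project k phi l h : {morph l : x y / x + y} ->
  affine_product k phi ->
  exists psi, affine_product k psi /\
    forall x (m : int), l x = m%:~R -> psi x = phi (x - h *~ m).
Proof.
move=> lD; elim=> {k phi} [k|k a phi aA phik [psi [psik psiE]]].
  by exists (fun=> 1); split=> //; exact: AffineProduct1.
exists (fun x => (a x - l x * (a h - a 0)) * psi x); split=> [|x m lx].
  by apply: AffineProductM psik => x y; rewrite aA lD (additive0 lD); ring.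
rewrite (psiE x m) //; congr (_ * _); rewrite lx.
have aD := affine_additive aA; apply/eqP; rewrite -(inj_eq (addIr (- a 0))).
apply/eqP; rewrite [RHS](additiveB aD x) (additiveMz m aD h) /= -mulrzl; ring.
Qed.

Lemma falling_ffact n j : \prod_(i < j) (n%:R - i%:R) = (n ^_ j)%:R :> rat.
Proof.
elim: j => [|j IH]; first by rewrite big_ord0.
rewrite big_ord_recr /= IH ffactnSr.
have [jn|nj] := leqP j n; first by rewrite natrM natrB.
by rewrite ffact_small // mul0r.
Qed.

Lemma deg_lt_iter (B : zmodType) (f : G -> B) k j h : (j <= k)%N ->
  deg_lt k f -> deg_lt (k - j) (iter j (diff h) f).
Proof.
elim: j => [|j IH] jk fk; first by rewrite subn0.
have := IH (ltnW jk) fk; rewrite -(prednK (_ : 0 < k - j)%N) ?subn_gt0 //.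
by move=> /(_ h); rewrite -subnS.
Qed.

(** Induction on the number of generators of a subgroup containing the points.
    Choose an additive l that is not 0 on it, and generators h, ys with l zero
    on ys. Each point is y + m h with y spanned by ys, and f (y + m h) has a
    Newton expansion whose coefficients C(m, j) are, up to the factor j!,
    products of j affine functions of the point, since m = l x / l h. So the
    j-th term is a combination of values of diff h ^ j f, of degree < k - j, at
    points spanned by ys, whose moments vanish too. *)
Lemma moments_span (B : zmodType) (I : finType) k xs (f : G -> B)
    (c : I -> int) (x : I -> G) : separated G -> deg_lt k f ->
  (forall i, zspan xs (x i)) ->
  (forall phi, affine_product k phi -> \sum_i phi (x i) *~ c i = 0) ->
  \sum_i f (x i) *~ c i = 0.
Proof.
move=> Gsep.
elim: {xs}(size xs) {-2}xs (leqnn (size xs)) k f c x => [|N IH] xs.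
  rewrite leqn0 => /nilP -> k f c x fk x0 mom.
  under eq_bigr => i _ do rewrite x0.
  case: k fk mom => [f0|k _ mom].
    by under eq_bigr => i _ do rewrite f0 mul0rz; rewrite big1_eq.
  have := mom _ (AffineProduct1 k); rewrite -!(raddf_sum (intmul _)) /=.
  by move/eqP; rewrite intr_eq0 => /eqP ->; rewrite mulr0z.
case: xs => [|a s] sN k f c x fk xP mom.
  exact: (IH [::] (leq0n _) _ _ _ _ fk xP mom).
have [a0|a0] := eqVneq a 0.
  apply: (IH s sN _ _ _ _ fk _ mom) => i; apply: zspan_trans (xP i) => b.
  rewrite inE => /orP[/eqP ->|]; last exact: zspan_mem.
  by rewrite a0; exact: zspan0.
have [l lD la] : exists2 l : G -> rat, {morph l : x y / x + y} & l a != 0.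
  apply: contrapT => nl; move/eqP: a0; apply; apply: Gsep => l lD.
  by apply: contrapT => /eqP la; apply: nl; exists l.
have [h [ys [ysN ys0 ysP]]] := zspan_kernel a s lD.
have lh : l h != 0.
  apply: contraNneq la => lh; apply/eqP.
  apply: (zspan_additive_eq0 lD _ (ysP a (mem_head _ _))) => b.
  by rewrite inE => /orP[/eqP ->|/ys0].
have /choice[m mP] i : exists m : int, zspan ys (x i - h *~ m).
  exact: (zspan_trans ysP (xP i)).
pose mu y := l y / l h.
have muD : {morph mu : x y / x + y} by move=> u v; rewrite /mu lD mulrDl.
have mux i : mu (x i) = (m i)%:~R.
  have := zspan_additive_eq0 lD ys0 (mP i).
  rewrite (additiveB lD) (additiveMz _ lD) => /eqP; rewrite subr_eq0 => /eqP lx.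
  by rewrite /mu lx -mulrzl mulfK.
(* Translating by M makes all multiplicities of h natural numbers. *)
pose M := (\sum_i absz (m i))%N.
have mM i : m i + M%:Z = (absz (m i + M%:Z))%:Z.
  suff : (absz (m i) <= M)%N by lia.
  by rewrite /M (bigD1 i) //= leq_addr.
pose n i := absz (m i + M%:Z); pose y i := x i - h *~ m i.
pose g z := f (z - h *+ M).
have gk : deg_lt k g by apply: deg_lt_shift.
have fE i : f (x i) = g (y i + h *+ n i).
  congr f; rewrite /y pmulrn -mM mulrzDr -pmulrn addrA subrK.
  by rewrite addrK.
under eq_bigr => i _ do rewrite fE (newton _ _ _ gk) mulrz_suml.
rewrite exchange_big big1 // => j _.
under eq_bigr => i _ do rewrite pmulrn -mulrzA.
apply: (IH ys (leq_trans ysN sN) (k - j)%N) => //.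
  by apply: deg_lt_iter => //; apply: ltnW.
move=> phi phik; have [psi [psik psiE]] := affine_product_project h muD phik.
have := affine_product_falling M j muD psik; rewrite subnK; last exact: ltnW.
move=> /mom momj; have jf : (j`!)%:R != 0 :> rat.
  by rewrite pnatr_eq0 -lt0n fact_gt0.
apply: (mulfI jf); rewrite mulr0 -[RHS]momj mulr_sumr; apply: eq_bigr => i _.
rewrite mux (psiE _ _ (mux i)) -/(y i).
have -> : (m i)%:~R + M%:R = (n i)%:R :> rat.
  by rewrite !pmulrn -intrD mM.
rewrite falling_ffact -bin_ffact natrM -[phi _ *~ _]mulrzr -[RHS]mulrzr intrM.
by rewrite -pmulrn; ring.
Qed.

End Moments.

(** * The universal ring of multiplicative maps of bounded degree *)

Definition combination (R : Type) (M : zmodType) (F : R -> M)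
    (s : seq (int * R)) : M :=
  \sum_(t <- s) F t.2 *~ t.1.

Section Combination.
Variables (R : Type) (M : zmodType).
Implicit Types (F : R -> M) (s : seq (int * R)).

Lemma combination_cat F s1 s2 :
  combination F (s1 ++ s2) = combination F s1 + combination F s2.
Proof. exact: big_cat. Qed.

Lemma combination1 F t : combination F [:: (1, t)] = F t.
Proof. by rewrite /combination big_seq1 mulr1z. Qed.

Definition combination_opp s := [seq (- t.1, t.2) | t <- s].

Lemma combination_oppE F s :
  combination F (combination_opp s) = - combination F s.
Proof.
rewrite /combination big_map -sumrN; apply: eq_bigr => t _.
by rewrite mulrNz.
Qed.

Lemma additive_combination (N : zmodType) (e : M -> N) F s :
  {morph e : x y / x + y} -> e (combination F s) = combination (e \o F) s.
Proof.
move=> eD; rewrite /combination (additive_sum _ _ eD); apply: eq_bigr => t _.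
exact: additiveMz.
Qed.

End Combination.

Lemma deg_lt_combination (A B : zmodType) (I : Type) k (F : A -> I -> B)
    (s : seq (int * I)) :
  (forall t, deg_lt k (F^~ t)) -> deg_lt k (fun x => combination (F x) s).
Proof.
move=> Fk; elim: s => [|[c t] s IH].
  by apply: deg_lt_zero => x; rewrite /combination big_nil.
have Fct : deg_lt k (fun x => F x t *~ c).
  have cD : {morph (fun y : B => y *~ c) : x y / x + y}.
    by move=> x y; exact: mulrzDl.
  exact: (deg_lt_post cD (Fk t)).
by apply: eq_deg_lt (deg_ltD Fct IH) => x; rewrite /combination big_cons.
Qed.

Section UniversalRing.
Variables (k : nat) (R : comPzRingType).
Implicit Types (s : seq (int * R)) (t : R).

Definition test_map : Type := {phi : R -> rat | deg_lt k phi}.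
Definition dirac t : test_map -> rat := fun phi => sval phi t.

Definition dirac_span : {pred test_map -> rat} :=
  fun q => `[< exists s, q = combination dirac s >].

(** An element is a formal integral combination of points of R, known only
    through its values on the rational-valued maps of degree < k. *)
Record univ := Univ {
  univ_val : test_map -> rat;
  univ_valP : univ_val \in dirac_span
}.

HB.instance Definition _ := [isSub for univ_val].
HB.instance Definition _ := [Choice of univ by <:].

Fact dirac_span_zmod_closed : zmod_closed dirac_span.
Proof.
split=> [|x y /asboolP[s ->] /asboolP[s' ->]]; apply/asboolP.
  by exists [::]; rewrite /combination big_nil.
exists (s ++ combination_opp s').
by rewrite combination_cat combination_oppE.
Qed.
HB.instance Definition _ :=
  GRing.isZmodClosed.Build (test_map -> rat) dirac_span dirac_span_zmod_closed.
HB.instance Definition _ := [SubChoice_isSubZmodule of univ by <:].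

Fact of_dirac t : dirac t \in dirac_span.
Proof. by apply/asboolP; exists [:: (1, t)]; rewrite combination1. Qed.

Definition univ_of t : univ := Univ (of_dirac t).

Lemma univ_valD : {morph univ_val : x y / x + y}.
Proof. by []. Qed.

Lemma univ_val_combination s :
  univ_val (combination univ_of s) = combination dirac s.
Proof. by rewrite (additive_combination _ _ univ_valD). Qed.

Lemma univ_combination (q : univ) : exists s, q = combination univ_of s.
Proof.
case: q => q qP; have /asboolP[s sE] := qP; exists s.
by apply: val_inj; rewrite /= univ_val_combination.
Qed.

Definition univ_repr (q : univ) := projT1 (cid (univ_combination q)).

Lemma univ_reprK q : combination univ_of (univ_repr q) = q.
Proof. by rewrite /univ_repr; case: (cid _). Qed.

Definition univ_eval (phi : test_map) (q : univ) : rat := univ_val q phi.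

Lemma univ_evalD phi : {morph univ_eval phi : x y / x + y}.
Proof. by []. Qed.

Lemma univ_eval_inj q : (forall phi, univ_eval phi q = 0) -> q = 0.
Proof. by move=> q0; apply: val_inj; apply: funext => phi; exact: q0. Qed.

Lemma univ_of_deg_lt : deg_lt k univ_of.
Proof.
apply: (deg_lt_separated univ_evalD univ_eval_inj) => -[phi phik].
exact: (eq_deg_lt _ phik).
Qed.

Lemma univ_separated : separated univ.
Proof.
by move=> q q0; apply: univ_eval_inj => phi; apply: q0; exact: univ_evalD.
Qed.

Lemma univ_additive_eq (M : zmodType) (e1 e2 : univ -> M) :
  {morph e1 : x y / x + y} -> {morph e2 : x y / x + y} ->
  (forall t, e1 (univ_of t) = e2 (univ_of t)) -> e1 =1 e2.
Proof.
move=> e1D e2D e12 q; rewrite -(univ_reprK q) !additive_combination //.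
by apply: eq_bigr => t _ /=; rewrite e12.
Qed.

Section Extension.
Variables (M : zmodType) (F : R -> M).

(** The additive extension of F. It is defined through an arbitrary
    representation, so it is meaningful when F is extendable. *)
Definition univ_ext (q : univ) : M := combination F (univ_repr q).

Definition extendable :=
  forall s, combination univ_of s = 0 -> combination F s = 0.

Hypothesis Fext : extendable.

Lemma univ_ext_combination s :
  univ_ext (combination univ_of s) = combination F s.
Proof.
apply/eqP; rewrite -subr_eq0 -combination_oppE -combination_cat; apply/eqP.
by apply: Fext; rewrite combination_cat combination_oppE univ_reprK subrr.
Qed.

Lemma univ_extD : {morph univ_ext : x y / x + y}.
Proof.
move=> x y; rewrite -{1}(univ_reprK x) -{1}(univ_reprK y) -combination_cat.
by rewrite univ_ext_combination combination_cat.
Qed.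

Lemma univ_ext_of t : univ_ext (univ_of t) = F t.
Proof.
by rewrite -(combination1 univ_of) univ_ext_combination combination1.
Qed.

End Extension.

(** Universality: the relations between points imposed by rational-valued maps
    hold for all maps of degree < k. *)
Lemma deg_lt_extendable (M : zmodType) (F : R -> M) :
  separated R -> deg_lt k F -> extendable F.
Proof.
move=> Rsep Fk s s0.
rewrite /combination (big_nth (0, 0)) big_mkord.
pose x (i : 'I_(size s)) := (nth (0, 0) s i).2.
apply: (@moments_span _ _ _ k (codom x) F _ x) => // [i|phi phik].
  by apply: zspan_mem; exact: codom_f.
have := congr1 (univ_eval (exist _ phi (affine_product_deg_lt phik))) s0.
rewrite (additive_combination _ _ (univ_evalD _)).
rewrite (additive0 (univ_evalD _)) => E.
by rewrite -[RHS]E /combination (big_nth (0, 0)) big_mkord.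
Qed.

Lemma deg_lt_test_extendable (F : R -> univ) :
  (forall phi, deg_lt k (univ_eval phi \o F)) -> extendable F.
Proof.
move=> Fk s s0; apply: univ_eval_inj => phi.
rewrite (additive_combination _ _ (univ_evalD phi)).
have := congr1 (univ_eval (exist _ _ (Fk phi))) s0.
by rewrite (additive_combination _ _ (univ_evalD _)) (additive0 (univ_evalD _)).
Qed.

Lemma left_mul_extendable t1 : extendable (fun t2 => univ_of (t1 * t2)).
Proof.
apply: deg_lt_test_extendable => phi.
by apply: (deg_lt_pre _ (proj2_sig phi)) => x y; exact: mulrDr.
Qed.

(** The bilinear extension of the product of R. *)
Definition univ_mul (q1 q2 : univ) : univ :=
  univ_ext (fun t1 => univ_ext (fun t2 => univ_of (t1 * t2)) q2) q1.

Lemma univ_mul_extendable q2 :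
  extendable (fun t1 => univ_ext (fun t2 => univ_of (t1 * t2)) q2).
Proof.
apply: deg_lt_test_extendable => phi.
apply: (eq_deg_lt (f := fun t1 =>
    combination (fun t2 => sval phi (t1 * t2)) (univ_repr q2))) => [t1|].
  by rewrite /= (additive_combination _ _ (univ_evalD phi)).
apply: deg_lt_combination => t2.
by apply: (deg_lt_pre _ (proj2_sig phi)) => x y; exact: mulrDl.
Qed.

Lemma univ_mul_of t1 t2 :
  univ_mul (univ_of t1) (univ_of t2) = univ_of (t1 * t2).
Proof.
rewrite /univ_mul (univ_ext_of (univ_mul_extendable _)).
by rewrite (univ_ext_of (@left_mul_extendable _)).
Qed.

Fact univ_mulC : commutative univ_mul.
Proof.
move=> q1 q2; rewrite /univ_mul /univ_ext /combination.
under eq_bigr => i _ do rewrite mulrz_suml.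
under [RHS]eq_bigr => i _ do rewrite mulrz_suml.
rewrite exchange_big; apply: eq_bigr => i _; apply: eq_bigr => j _.
by rewrite mulrC mulrzAC.
Qed.

Fact univ_mulDl : left_distributive univ_mul +%R.
Proof. move=> q1 q2 q3; exact: (univ_extD (@univ_mul_extendable q3)). Qed.

Fact univ_mulDr : right_distributive univ_mul +%R.
Proof. by move=> q1 q2 q3; rewrite !(univ_mulC q1) univ_mulDl. Qed.

Fact univ_mul1 : left_id (univ_of 1) univ_mul.
Proof.
apply: univ_additive_eq => [x y|//|t]; first exact: univ_mulDr.
by rewrite univ_mul_of mul1r.
Qed.

Fact univ_mulA : associative univ_mul.
Proof.
move=> q1 q2 q3; move: q1.
apply: univ_additive_eq => [x y|x y|t1]; rewrite ?univ_mulDl //.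
move: q2; apply: univ_additive_eq => [x y|x y|t2].
- by rewrite univ_mulDl univ_mulDr.
- by rewrite univ_mulDr univ_mulDl.
move: q3; apply: univ_additive_eq => [x y|x y|t3]; rewrite ?univ_mulDr //.
by rewrite !univ_mul_of mulrA.
Qed.

HB.instance Definition _ := GRing.Zmodule_isComPzRing.Build univ
  univ_mulA univ_mulC univ_mul1 univ_mulDl.

Lemma univ_ofM : {morph univ_of : x y / x * y}.
Proof. by move=> x y; rewrite [RHS]univ_mul_of. Qed.

Lemma univ_of1 : univ_of 1 = 1.
Proof. by []. Qed.

Lemma univ_ofX n : {morph univ_of : x / x ^+ n}.
Proof.
move=> x; elim: n => [|n IH]; first by rewrite !expr0 univ_of1.
by rewrite !exprS univ_ofM IH.
Qed.

Lemma univ_extM (B : comPzRingType) (F : R -> B) : extendable F ->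
  {morph F : x y / x * y} -> {morph univ_ext F : x y / x * y}.
Proof.
move=> Fext FM q1 q2; have FD := univ_extD Fext; move: q1.
apply: univ_additive_eq => [x y|x y|t1]; rewrite ?mulrDl ?FD ?mulrDl //.
move: q2; apply: univ_additive_eq => [x y|x y|t2].
- by rewrite mulrDr FD.
- by rewrite FD mulrDr.
by rewrite -univ_ofM !univ_ext_of.
Qed.

End UniversalRing.

(** * Homomorphisms that need not preserve 1 *)

Section NonunitalHom.
Variables (A B C : comPzRingType).

Lemma nonunital_hom_rmorphism (g : {rmorphism A -> B}) : nonunital_hom g.
Proof. by split; [exact: rmorphD|exact: rmorphM]. Qed.

Lemma nonunital_hom_comp (f : A -> B) (g : B -> C) :
  nonunital_hom f -> nonunital_hom g -> nonunital_hom (g \o f).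
Proof. by move=> [fD fM] [gD gM]; split=> x y /=; rewrite ?fD ?fM ?gD ?gM. Qed.

Lemma nonunital_homX (g : A -> B) n x : nonunital_hom g ->
  g (x ^+ n.+1) = g x ^+ n.+1.
Proof. by move=> [_ gM]; elim: n => // n IH; rewrite exprS gM IH -exprS. Qed.

End NonunitalHom.

Section SeparatedRings.

Lemma separated_torsion_free (G : zmodType) : separated G ->
  forall n (x : G), x *+ n.+1 = 0 -> x = 0.
Proof.
move=> Gsep n x xn; apply: Gsep => l lD.
have := additiveMz n.+1 lD x; rewrite /= -!pmulrn xn (additive0 lD).
by move/esym/eqP; rewrite mulrn_eq0 => /eqP.
Qed.

Lemma separated_zpoly (V : choiceType) : separated (zpoly V).
Proof.
move=> g g0; apply/malgP => k; apply/eqP; rewrite mcoeff0 -(intr_eq0 rat).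
apply/eqP; apply: (g0 (fun g => (mcoeff k g)%:~R)) => x y.
by rewrite mcoeffD intrD.
Qed.

Lemma separated_int : separated int.
Proof.
move=> z z0; apply/eqP; rewrite -(intr_eq0 rat); apply/eqP.
by apply: (z0 intr) => x y; rewrite intrD.
Qed.

Lemma separated_prod (G H : zmodType) :
  separated G -> separated H -> separated (G * H)%type.
Proof.
move=> Gsep Hsep [g h] gh0; congr pair.
  by apply: Gsep => l lD; apply: (gh0 (l \o fst)) => x y; rewrite /= lD.
by apply: Hsep => l lD; apply: (gh0 (l \o snd)) => x y; rewrite /= lD.
Qed.

End SeparatedRings.

Section Unitalization.
Variables (A B : comPzRingType) (g : A -> B).
Hypothesis gH : nonunital_hom g.

(** A homomorphism g that need not preserve 1, extended to a unital one by
    sending the idempotent (0, 1) to 1 - g 1. *)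
Definition unitalized of nonunital_hom g :=
  fun x : A * int => g x.1 + (1 - g 1) *~ x.2.

Fact unitalized_zmod_morphism : zmod_morphism (unitalized gH).
Proof.
move=> x y; rewrite /unitalized /= (additiveB gH.1) mulrzBr.
by rewrite opprD addrACA.
Qed.

Fact unitalized_monoid_morphism : monoid_morphism (unitalized gH).
Proof.
split=> [|x y]; first by rewrite /unitalized /= mulr1z addrC subrK.
rewrite /unitalized /= gH.2.
have g1 z : g z * (1 - g 1) = 0 by rewrite mulrBr -gH.2 !mulr1 subrr.
have e2 : (1 - g 1) * (1 - g 1) = 1 - g 1 by rewrite mulrBl g1 subr0 mul1r.
rewrite mulrDl !mulrDr !mulrzAr !mulrzAl g1 [(1 - g 1) * g _]mulrC g1 e2.
by rewrite !mul0rz addr0 add0r -mulrzA mulrC.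
Qed.

HB.instance Definition _ := GRing.isZmodMorphism.Build (A * int)%type B
  (unitalized gH) unitalized_zmod_morphism.
HB.instance Definition _ := GRing.isMonoidMorphism.Build (A * int)%type B
  (unitalized gH) unitalized_monoid_morphism.

Definition inl0 (x : A) : A * int := (x, 0).

Lemma inl0_nonunital : nonunital_hom inl0.
Proof. by split=> x y; congr pair; rewrite ?addr0 ?mulr0. Qed.

Lemma unitalized_inl0 : unitalized gH \o inl0 = g.
Proof. by apply: funext => x; rewrite /unitalized /= mulr0z addr0. Qed.

End Unitalization.

(** * Witt vectors and homomorphisms that need not preserve 1 *)

Section WittFunctoriality.
Variables (p : nat) (p_pr : prime p) (m : option nat).
Local Notation W := (witt p_pr m).

Lemma wmap_comp (A B C : comPzRingType) (f : A -> B) (g : B -> C) (a : W A) :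
  wmap g (wmap f a) = wmap (g \o f) a.
Proof. exact: wittP. Qed.

Lemma ghost_wmap (A B : comPzRingType) (g : A -> B) (a : W A) j :
  nonunital_hom g -> ghost (wmap g a) j = g (ghost a j).
Proof.
move=> gH; have g0 := additive0 gH.1.
have gc i : wcoef (wmap g a) i = g (wcoef a i).
  by rewrite /wcoef; case: insub => //=; rewrite g0.
rewrite /ghost /ghost_seq (additive_sum _ _ gH.1); apply: eq_bigr => i _.
rewrite gc; have /prednK <- : (0 < p ^ (val j - i))%N.
  by rewrite expn_gt0 prime_gt0.
rewrite -(nonunital_homX _ _ gH).
by have := additiveMz (p ^ i)%N gH.1 (wcoef a i ^+ (p ^ (val j - i)).-1.+1).
Qed.

Lemma witt_separated_inj (R : comPzRingType) (a b : W R) : separated R ->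
  (forall j, ghost a j = ghost b j) -> a = b.
Proof. by move=> /separated_torsion_free; exact: ghost_inj. Qed.

Lemma witt_prod_inj (A B : comPzRingType) (a b : W (A * B)%type) :
  wmap fst a = wmap fst b -> wmap snd a = wmap snd b -> a = b.
Proof.
move=> ab1 ab2; apply: wittP => j.
have := congr1 (fun w => wcomp w j) ab1.
have := congr1 (fun w => wcomp w j) ab2.
by rewrite /=; case: (wcomp a j) (wcomp b j) => [? ?] [? ?] /= -> ->.
Qed.

Lemma wmap_inl0_nonunital (A : comPzRingType) :
  nonunital_hom (wmap (@inl0 A) : W A -> W (A * int)%type).
Proof.
have fst_inl0 (a : W A) : wmap fst (wmap (@inl0 A) a) = a by exact: wittP.
have snd_inl0 (a : W A) : wmap snd (wmap (@inl0 A) a) = 0.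
  by rewrite -[0]/(wzero p_pr m int) wzero.unlock; exact: wittP.
split=> a b; apply: witt_prod_inj.
- by rewrite (wmapD (fst : {rmorphism A * int -> A})) !fst_inl0.
- by rewrite (wmapD (snd : {rmorphism A * int -> int})) !snd_inl0 addr0.
- by rewrite (wmapM (fst : {rmorphism A * int -> A})) !fst_inl0.
- by rewrite (wmapM (snd : {rmorphism A * int -> int})) !snd_inl0 mulr0.
Qed.

(** W of the inclusion in A * int is seen to be a homomorphism by projecting to
    the two factors, and g is a unital homomorphism after that inclusion. *)
Lemma wmap_nonunital (A B : comPzRingType) (g : A -> B) : nonunital_hom g ->
  nonunital_hom (wmap g : W A -> W B).
Proof.
move=> gH; pose h : {rmorphism A * int -> B} := unitalized gH.
have -> : (wmap g : W A -> W B) = wmap h \o wmap (@inl0 A).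
  by apply: funext => a; rewrite /= wmap_comp /h unitalized_inl0.
apply: nonunital_hom_comp; first exact: wmap_inl0_nonunital.
by split; [exact: (wmapD h)|exact: (wmapM h)].
Qed.

End WittFunctoriality.

(** * Witt vectors of the universal ring *)

Section Factorization.
Variables (k : nat) (R B : comPzRingType) (f : R -> B).
Hypotheses (Rsep : separated R) (fk : deg_lt k f).
Hypothesis (fM : {morph f : x y / x * y}).

Lemma univ_ext_nonunital : nonunital_hom (univ_ext (k := k) f).
Proof.
have fl := deg_lt_extendable Rsep fk.
by split; [exact: univ_extD|exact: univ_extM].
Qed.

Lemma univ_ext_factor : univ_ext f \o @univ_of k R = f.
Proof.
by apply: funext => x; rewrite /= univ_ext_of //; exact: deg_lt_extendable.
Qed.

End Factorization.

Definition admissible (p : nat) (A B : comPzRingType) (f : A -> B) : Prop :=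
  deg_lt p f /\ {morph f : x y / x * y}.

Section AdmissibleMaps.
Variables (p : nat).

Lemma admissible_pre_nonunital (A B C : comPzRingType) (f : A -> B)
    (g : B -> C) : nonunital_hom f -> admissible p g -> admissible p (g \o f).
Proof.
move=> [fD fM] [gp gM]; split; first exact: (deg_lt_pre fD gp).
by move=> x y; rewrite /= fM gM.
Qed.

Lemma admissible_nonunital (A B : comPzRingType) (f : A -> B) :
  prime p -> nonunital_hom f -> admissible p f.
Proof.
move=> p_pr [fD fM]; split=> //.
by apply: deg_ltW (deg_lt_additive fD); exact: prime_gt1.
Qed.

Lemma univ_of_admissible k (R : comPzRingType) : (k <= p)%N ->
  admissible p (@univ_of k R).
Proof.
move=> kp; split; last exact: univ_ofM.
exact: deg_ltW kp (@univ_of_deg_lt k R).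
Qed.

End AdmissibleMaps.

Section UniversalWitt.
Variables (p : nat) (p_pr : prime p) (V : choiceType).
Local Notation T := (zpoly V).
Local Notation Q := (univ p T : comPzRingType).

Let F : T -> Q := @univ_of p T \o @frob_lift p V.

Let F_admissible : admissible p F.
Proof.
apply: admissible_pre_nonunital; last exact: univ_of_admissible.
exact: nonunital_hom_rmorphism.
Qed.

Definition univ_frob : Q -> Q := univ_ext F.

Lemma univ_frob_of t : univ_frob (univ_of p t) = univ_of p (frob_lift p t).
Proof.
by apply: univ_ext_of; apply: deg_lt_extendable F_admissible.1;
  exact: separated_zpoly.
Qed.

Let univ_frob_nonunital : nonunital_hom univ_frob :=
  univ_ext_nonunital (@separated_zpoly V) F_admissible.1 F_admissible.2.

Fact univ_frob_zmod_morphism : zmod_morphism univ_frob.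
Proof. exact: additiveB univ_frob_nonunital.1. Qed.

Fact univ_frob_monoid_morphism : monoid_morphism univ_frob.
Proof.
split; last exact: univ_frob_nonunital.2.
by rewrite -univ_of1 univ_frob_of rmorph1.
Qed.

HB.instance Definition _ := GRing.isZmodMorphism.Build Q Q
  univ_frob univ_frob_zmod_morphism.
HB.instance Definition _ := GRing.isMonoidMorphism.Build Q Q
  univ_frob univ_frob_monoid_morphism.

(** It is enough to check the points, by [cong_frob_sum]; there the map univ_of,
    of degree < p, preserves the congruence satisfied by [frob_lift]. *)
Lemma univ_frobP (x : Q) : cong p (univ_frob x) (x ^+ p).
Proof.
rewrite -(univ_reprK x); apply: (cong_frob_sum p_pr) => t /=.
rewrite univ_frob_of.
rewrite -univ_ofX -[X in cong X](expn1 p).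
apply: (deg_lt_cong p_pr); first exact: univ_of_deg_lt.
by rewrite expn1; apply: frob_liftP.
Qed.

(** Dwork's congruences for the ghost components of r, transported by univ_of.
*)
Lemma witt_univ_ex m (r : witt p_pr m T) : exists b : witt p_pr m Q,
  forall j, ghost b j = univ_of p (ghost r j).
Proof.
have [s sE] : exists s, forall j,
    ghost_seq p s j = univ_of p (ghost_seq p (wcoef r) j).
  apply: (dwork p_pr (phi := univ_frob) univ_frobP) => j.
  rewrite [X in cong _ _ X]univ_frob_of.
  apply: (deg_lt_cong p_pr); first exact: univ_of_deg_lt.
  exact: (ghost_seq_cong p_pr (frob_liftP p_pr (V := V))).
by exists (Witt p_pr (fun j => s (val j))) => j; rewrite ghost_Witt sE.
Qed.

Definition witt_univ m (r : witt p_pr m T) : witt p_pr m Q :=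
  projT1 (cid (witt_univ_ex r)).

Lemma ghost_witt_univ m (r : witt p_pr m T) j :
  ghost (witt_univ r) j = univ_of p (ghost r j).
Proof. by rewrite /witt_univ; case: (cid _) => b /= ->. Qed.

End UniversalWitt.

(** * The extension of the Witt vector functor *)

Section WittExtension.
Variables (p : nat) (p_pr : prime p) (m : option nat).
Local Notation W := (witt p_pr m).
Local Notation T := (fun A : comPzRingType => zpoly A).
Local Notation ev A := (@zeval A A id).

Definition witt_vars (A : comPzRingType) (a : W A) : W (T A) :=
  Witt p_pr (fun j => zvar (wcomp a j)).

Lemma witt_varsK (A : comPzRingType) (a : W A) : wmap (ev A) (witt_vars a) = a.
Proof. by apply: wittP => j; rewrite /= zeval_var. Qed.

Definition wext (A B : comPzRingType) (f : A -> B) (a : W A) : W B :=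
  wmap (univ_ext (f \o ev A)) (witt_univ (witt_vars a)).

Lemma ev_nonunital (A : comPzRingType) : nonunital_hom (ev A).
Proof. exact: (nonunital_hom_rmorphism (ev A : {rmorphism T A -> A})). Qed.

Lemma ext_ev_nonunital (A B : comPzRingType) (f : A -> B) : admissible p f ->
  nonunital_hom (univ_ext (k := p) (f \o ev A)).
Proof.
move=> fp; have [] := admissible_pre_nonunital (ev_nonunital A) fp.
exact: (univ_ext_nonunital (@separated_zpoly A)).
Qed.

Lemma ext_ev_of (A B : comPzRingType) (f : A -> B) t : admissible p f ->
  univ_ext (f \o ev A) (univ_of p t) = f (ev A t).
Proof.
move=> fp; have [fk _] := admissible_pre_nonunital (ev_nonunital A) fp.
by apply: univ_ext_of; apply: deg_lt_extendable fk; exact: separated_zpoly.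
Qed.

Lemma ghost_wext (A B : comPzRingType) (f : A -> B) (a : W A) j :
  admissible p f -> ghost (wext f a) j = f (ghost a j).
Proof.
move=> fp; rewrite ghost_wmap; last exact: ext_ev_nonunital.
rewrite ghost_witt_univ ext_ev_of // -ghost_wmap ?witt_varsK //.
exact: ev_nonunital.
Qed.

Lemma wext_comp_ghost (A B S : comPzRingType) (f : A -> B) (g : B -> S)
    (a : W A) : separated S -> admissible p f -> admissible p g ->
  admissible p (g \o f) -> wext g (wext f a) = wext (g \o f) a.
Proof.
move=> Ssep fp gp gfp; apply: witt_separated_inj => // j.
by rewrite !ghost_wext.
Qed.

Lemma wext_post (A B C : comPzRingType) (f : A -> B) (g : B -> C) (a : W A) :
  nonunital_hom g -> wext (g \o f) a = wmap g (wext f a).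
Proof.
move=> [gD _]; rewrite /wext wmap_comp; congr wmap; apply: funext => q.
by rewrite /= /univ_ext (additive_combination _ _ gD).
Qed.

(** The map of the variables T A -> T B carries the lift of a to the lift of its
    image, and acts on the universal rings. *)
Lemma wext_pre_rmorphism (A B C : comPzRingType) (g : {rmorphism A -> B})
    (f : B -> C) (a : W A) : admissible p f ->
  wext f (wmap g a) = wext (f \o g) a.
Proof.
move=> fp; pose G : T A -> T B := zeval (fun x => zvar (g x)).
have evG t : ev B (G t) = g (ev A t).
  rewrite [LHS](rmorph_zeval (ev B)) [RHS](rmorph_zeval g); congr (zeval _ t).
  by apply: funext => x; rewrite /= zeval_var.
have GH : nonunital_hom G.
  exact: (nonunital_hom_rmorphism (G : {rmorphism T A -> T B})).
pose uG : T A -> univ p (T B) := @univ_of p (T B) \o G.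
have uGp : admissible p uG.
  by apply: admissible_pre_nonunital GH _; exact: univ_of_admissible.
have Asep : separated (T A) := @separated_zpoly A.
have uGl := deg_lt_extendable Asep uGp.1.
have uGH := univ_ext_nonunital Asep uGp.1 uGp.2.
have varsE : witt_vars (wmap g a) = wmap G (witt_vars a).
  by apply: wittP => i; rewrite /= /G zeval_var.
have -> : wext f (wmap g a) =
    wmap (univ_ext (f \o ev B)) (wmap (univ_ext uG) (witt_univ (witt_vars a))).
  congr wmap; apply: witt_separated_inj => [|j]; first exact: univ_separated.
  rewrite ghost_witt_univ ghost_wmap // ghost_witt_univ univ_ext_of //.
  by rewrite varsE ghost_wmap.
have fgp : admissible p (f \o g).
  exact: admissible_pre_nonunital (nonunital_hom_rmorphism g) fp.
rewrite wmap_comp /wext; congr wmap; apply: funext.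
apply: univ_additive_eq => [x y|x y|t].
- by rewrite /= uGH.1 (ext_ev_nonunital fp).1.
- exact: (ext_ev_nonunital fgp).1.
by rewrite /= univ_ext_of // ext_ev_of // ext_ev_of // evG.
Qed.

(** Lift a to T A and go to A through the ring T A * int: the inclusion i there
    does not preserve 1, but lies between separated rings, and the rest h is
    unital. *)
Lemma wext_pre_nonunital (A B C : comPzRingType) (g : A -> B)
    (f : B -> C) (a : W A) : nonunital_hom g -> admissible p f ->
  wext f (wmap g a) = wext (f \o g) a.
Proof.
move=> gH fp.
have gevH : nonunital_hom (g \o ev A) := nonunital_hom_comp (ev_nonunital A) gH.
pose R : comPzRingType := (T A * int)%type.
have Rsep : separated R.
  exact: separated_prod (@separated_zpoly A) separated_int.
pose h : {rmorphism R -> B} := unitalized gevH.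
pose i : T A -> R := @inl0 (T A).
have iH : nonunital_hom i := inl0_nonunital (T A).
have hi : h \o i = g \o ev A := unitalized_inl0 gevH.
pose r := witt_vars a.
have fhp : admissible p (f \o h).
  exact: admissible_pre_nonunital (nonunital_hom_rmorphism h) fp.
pose F : univ p R -> C := univ_ext (f \o h).
have FH : nonunital_hom F := univ_ext_nonunital Rsep fhp.1 fhp.2.
have FE : F \o univ_of p (R := R) = f \o h := univ_ext_factor Rsep fhp.1.
have up : admissible p (@univ_of p R) := univ_of_admissible R (leqnn p).
have -> : wmap g a = wmap h (wmap i r).
  by rewrite wmap_comp hi -wmap_comp /r witt_varsK.
have -> : wext (f \o g) a = wext (f \o g) (wmap (ev A) r) by rewrite witt_varsK.
have fgp := admissible_pre_nonunital gH fp.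
rewrite (wext_pre_rmorphism (ev A : {rmorphism _ -> _})) //.
rewrite wext_pre_rmorphism //.
have -> : (f \o g) \o ev A = F \o (univ_of p (R := R) \o i).
  rewrite -[(f \o g) \o _]/(f \o (g \o ev A)) -hi.
  by rewrite -[f \o _]/((f \o h) \o i) -FE.
rewrite -FE (wext_post _ _ FH) (wext_post _ _ FH); congr (wmap F _).
apply: witt_separated_inj => [|j]; first exact: univ_separated.
have uip := admissible_pre_nonunital iH up.
by rewrite (ghost_wext _ _ up) (ghost_wext _ _ uip) (ghost_wmap _ _ iH).
Qed.

Lemma wext_id (S : comPzRingType) (a : W S) : separated S -> wext id a = a.
Proof.
move=> Ssep; apply: witt_separated_inj => // j; rewrite ghost_wext //.
by apply: admissible_nonunital => //; split.
Qed.

(** By naturality it is enough to treat the identity of T A. *)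
Lemma wext_nonunital (A B : comPzRingType) (f : A -> B) :
  nonunital_hom f -> wext f =1 wmap f.
Proof.
move=> fH a; rewrite -{1}(witt_varsK a).
have fp := admissible_nonunital p_pr fH.
rewrite (wext_pre_rmorphism (ev A : {rmorphism _ -> _})) //.
rewrite -[f \o _]/((f \o ev A) \o id) wext_post; last first.
  exact: nonunital_hom_comp (ev_nonunital A) fH.
rewrite wext_id; last exact: separated_zpoly.
by rewrite -wmap_comp witt_varsK.
Qed.

Lemma mult_polynomial_admissible n (A B : comPzRingType) (f : A -> B) :
  (n < p)%N -> mult_polynomial_map n f -> admissible p f.
Proof.
by move=> np [/polynomial_mapP fn fM]; split=> //; exact: deg_ltW fn.
Qed.

Lemma factor_ev n (A B : comPzRingType) (f : A -> B) :
  mult_polynomial_map n f ->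
  exists2 h : univ n.+1 (T A) -> B, nonunital_hom h &
    f \o ev A = h \o univ_of n.+1 (R := T A).
Proof.
move=> [/polynomial_mapP fn fM].
have [fk fm] : admissible n.+1 (f \o ev A).
  by apply: admissible_pre_nonunital; [exact: ev_nonunital|split].
exists (univ_ext (f \o ev A)).
  exact: (univ_ext_nonunital (@separated_zpoly A)).
by rewrite (univ_ext_factor (@separated_zpoly A)).
Qed.

(** The degree n.+1 enters through the factorization over [univ n.+1 (T A)],
    although [wext] is built on [univ p (T A)]: into the former ring, W of the
    universal map has the ghost components of a map of degree n. *)
Lemma wext_mult_polynomial n (A B : comPzRingType) (f : A -> B) :
  (n < p)%N -> mult_polynomial_map n f -> mult_polynomial_map n (wext f).
Proof.
move=> np fn; have fp := mult_polynomial_admissible np fn.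
have [h hH fE] := factor_ev fn.
have up := univ_of_admissible (T A) np.
pose U : W (T A) -> W (univ n.+1 (T A)) := wext (@univ_of n.+1 (T A)).
have ghostE (r : W (T A)) j : ghost (U r) j = univ_of n.+1 (ghost r j).
  exact: ghost_wext.
have fU r : wext f (wmap (ev A) r) = wmap h (U r).
  by rewrite (wext_pre_rmorphism (ev A : {rmorphism _ -> _})) // fE wext_post.
(* Unfolding U would make the unifications below diverge. *)
clearbody U; have usep := @univ_separated n.+1 (T A).
have evW : nonunital_hom (wmap (ev A) : W (T A) -> W A).
  exact: wmap_nonunital (ev_nonunital A).
have hW : nonunital_hom (wmap h : W _ -> W B) := wmap_nonunital p_pr m hH.
have ev_surj (a : W A) : exists r : W (T A), wmap (ev A) r = a.
  by exists (witt_vars a); exact: witt_varsK.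
split.
  apply/polynomial_mapP; apply: (deg_lt_surj evW.1 ev_surj).
  apply: (eq_deg_lt (fun r => esym (fU r))); apply: (deg_lt_post hW.1).
  have ghost_additive (S : comPzRingType) j :
    {morph (fun b : W S => ghost b j) : x y / x + y}.
    by move=> x y; exact: ghostD.
  apply: (deg_lt_separated (ghost_additive _)) => [b b0|j].
    apply: witt_separated_inj => // j.
    by rewrite b0 (additive0 (ghost_additive _ j)).
  apply: (eq_deg_lt (f := @univ_of n.+1 (T A) \o (fun r : W _ => ghost r j))).
    by move=> r; rewrite /= ghostE.
  exact: (deg_lt_pre (ghost_additive _ j) (@univ_of_deg_lt n.+1 (T A))).
move=> a b; have [r <-] := ev_surj a; have [s <-] := ev_surj b.
rewrite -evW.2 !fU -hW.2; congr wmap; apply: witt_separated_inj => // j.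
by rewrite ghostE !ghostM !ghostE univ_ofM.
Qed.

(** Both sides are pushed forward from a universal ring over [univ n.+1 (T A)],
    where they have the same ghost components. *)
Lemma wext_comp n k (A B C : comPzRingType) (f : A -> B) (g : B -> C) :
  (n < p)%N -> (k < p)%N -> (n * k < p)%N ->
  mult_polynomial_map n f -> mult_polynomial_map k g ->
  wext g \o wext f =1 wext (g \o f).
Proof.
move=> np kp nkp fn gk a /=.
have fp := mult_polynomial_admissible np fn.
have gp := mult_polynomial_admissible kp gk.
have [h hH fE] := factor_ev fn.
pose Q := univ n.+1 (T A).
have Qsep : separated Q := @univ_separated n.+1 (T A).
have [gk' gM] : admissible k.+1 (g \o h).
  by apply: admissible_pre_nonunital hH _; case: gk => /polynomial_mapP.
pose h' : univ k.+1 Q -> C := univ_ext (g \o h).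
have h'H : nonunital_hom h' := univ_ext_nonunital Qsep gk' gM.
have gE : g \o h = h' \o univ_of k.+1 (R := Q).
  by rewrite /h' (univ_ext_factor Qsep gk').
pose u1 := @univ_of n.+1 (T A); pose u2 := @univ_of k.+1 Q.
have u1p : admissible p u1 := univ_of_admissible (T A) np.
have u2p : admissible p u2 := univ_of_admissible Q kp.
have u12p : admissible p (u2 \o u1).
  split; last by move=> x y /=; rewrite /u1 /u2 !univ_ofM.
  by apply: deg_ltW nkp (deg_lt_comp _ _); exact: univ_of_deg_lt.
have gfE : (g \o f) \o ev A = h' \o (u2 \o u1).
  by rewrite -[LHS]/(g \o (f \o ev A)) fE -[LHS]/((g \o h) \o u1) gE.
have gfp : admissible p (g \o f).
  split; last by move=> x y /=; rewrite fp.2 gp.2.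
  case: fn gk => [/polynomial_mapP fn _] [/polynomial_mapP gk _].
  exact: deg_ltW nkp (deg_lt_comp fn gk).
rewrite -(witt_varsK a); move: (witt_vars a) => r.
rewrite !(wext_pre_rmorphism (ev A : {rmorphism _ -> _})) //.
rewrite gfE fE (wext_post u1 r hH) (wext_post (u2 \o u1) r h'H).
rewrite wext_pre_nonunital // gE (wext_post u2 _ h'H); congr (wmap h' _).
apply: wext_comp_ghost => //; exact: univ_separated.
Qed.

Lemma univ_of_polynomial n (R : comPzRingType) :
  mult_polynomial_map n (@univ_of n.+1 R).
Proof.
split; last exact: univ_ofM.
by apply/polynomial_mapP; exact: univ_of_deg_lt.
Qed.

(** Compatibility with composition, applied to the homomorphisms T A -> A and h,
    leaves no freedom except on the universal map, whose target has an
    injective ghost map. *)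
Lemma witt_extension_factor
    (X : forall A B : comPzRingType, (A -> B) -> W A -> W B) n
    (A B : comPzRingType) (f : A -> B) (h : univ n.+1 (T A) -> B) (a : W A) :
  witt_extension X -> (n < p)%N -> mult_polynomial_map n f ->
  nonunital_hom h -> f \o ev A = h \o univ_of n.+1 (R := T A) ->
  X A B f a = wmap h (X _ _ (@univ_of n.+1 (T A)) (witt_vars a)).
Proof.
move=> [X_hom _ X_comp] np fn hH fE; have p1 := prime_gt1 p_pr.
have hom1 (R S : comPzRingType) (g : R -> S) :
    nonunital_hom g -> mult_polynomial_map 1 g.
  move=> [gD gM]; split=> //; apply/polynomial_mapP; exact: deg_lt_additive.
have evn := hom1 _ _ _ (ev_nonunital A).
have n1 : (n * 1 < p)%N by rewrite muln1.
have n1' : (1 * n < p)%N by rewrite mul1n.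
rewrite -{1}(witt_varsK a) -(X_hom _ _ _ (ev_nonunital A)).
rewrite [LHS](X_comp _ _ _ _ _ _ _ p1 np n1' evn fn) fE -(X_hom _ _ _ hH).
apply/esym/(X_comp _ _ _ _ _ _ _ np p1 n1 _ (hom1 _ _ _ hH)).
exact: univ_of_polynomial.
Qed.

End WittExtension.

Theorem corollaryB (p : nat) (p_pr : prime p) (m : option nat)
    (m_ge1 : below m 0) :
  exists W : forall A B : comPzRingType,
      (A -> B) -> witt p_pr m A -> witt p_pr m B,
    [/\ witt_extension W,
        ghost_compatible W &
        forall W' : forall A B : comPzRingType,
            (A -> B) -> witt p_pr m A -> witt p_pr m B,
          witt_extension W' -> ghost_compatible W' ->
          forall (n : nat) (A B : comPzRingType) (f : A -> B),
            (n < p)%N -> mult_polynomial_map n f -> W' A B f =1 W A B f].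
Proof.
have wext_ghost : ghost_compatible (@wext p p_pr m).
  move=> n A B f np fn a j; apply: ghost_wext.
  exact: mult_polynomial_admissible fn.
have wext_ext : witt_extension (@wext p p_pr m).
  split; [exact: wext_nonunital|exact: wext_mult_polynomial|exact: wext_comp].
exists (@wext p p_pr m); split=> //.
move=> X X_ext X_ghost n A B f np fn a; have [h hH fE] := factor_ev fn.
rewrite (witt_extension_factor a X_ext np fn hH fE).
rewrite (witt_extension_factor a wext_ext np fn hH fE).
have un := univ_of_polynomial n (zpoly A).
congr wmap; apply: witt_separated_inj => [|j]; first exact: univ_separated.
by rewrite (X_ghost _ _ _ _ np un) (wext_ghost _ _ _ _ np un).
Qed.
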